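(* Let $G$ be a large group, let $H$ be a normal subgroup of $G$ of finite index admitting a surjective homomorphism onto a non-cyclic free group, and let $g_1,\ldots,g_k$ be elements of $H$. Then the quotient group $G/\langle\langle g_1^{n},\ldots,g_k^{n}\rangle\rangle^{G}$ is large for all but finitely many $n\in\mathbb{N}$.
   Context: A group $G$ is called large if some finite index subgroup of $G$ admits a surjective homomorphism onto a non-cyclic free group. For a subset $S$ of a group $G$, $\langle\langle S\rangle\rangle^{G}$ denotes the normal closure of $S$ in $G$. The group $G$ is not assumed to be finitely generated. *)

(* Defs.v *)
From HB Require Import structures.
From mathcomp Require Import all_boot.
From mathcomp Require Import boolp classical_sets cardinality.

Set Implicit Arguments.
Unset Strict Implicit.
Unset Printing Implicit Defensive.

Import Algebra.

Local Open Scope group_scope.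
Local Open Scope quotient_scope.
Local Open Scope classical_set_scope.

(* A group is a [groupType] (possibly infinite); its [choiceType] structure is
   no restriction, since [boolp] provides one on every type.  A subgroup of [G]
   is a [groupClosed G], and a normal subgroup is a [normalClosed G]. *)

HB.mixin Record isNormalClosed (G : groupType) (S : {pred G}) := {
  gpredJ_closed : forall x y : G, x \in S -> x ^ y \in S
}.

#[short(type="normalClosed")]
HB.structure Definition NormalClosed (G : groupType) :=
  {S of GroupClosed G S & isNormalClosed G S}.

Section SubgroupType.
Variables (G : groupType) (S : groupClosed G).

Definition subgroup_of : Type := {x : G | x \in S}.

HB.instance Definition _ := [isSub of subgroup_of for @sval G _].
HB.instance Definition _ := [Choice of subgroup_of by <:].

Fact subgroup_of_closed : group_closed (fun x : G => x \in S).
Proof. by split=> [|x y xS yS]; [exact: gpred1 | exact: gpredF]. Qed.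

HB.instance Definition _ :=
  SubChoice_isSubGroup.Build G (fun x : G => x \in S) subgroup_of
    subgroup_of_closed.

End SubgroupType.

Definition left_coset (G : groupType) (S : groupClosed G) (x : G) : set G :=
  [set x * h | h in [set h | h \in S]].

Definition finite_index (G : groupType) (S : groupClosed G) : Prop :=
  finite_set (range (left_coset S)).

Section QuotientGroup.
Variables (G : groupType) (N : normalClosed G).
Implicit Types x y z : G.

Definition coset_rel : rel G := fun x y => x^-1 * y \in N.

Fact coset_rel_equiv : equiv_class_of coset_rel.
Proof.
rewrite /coset_rel; split=> [x|x y|y x z xy yz].
- by rewrite mulVg gpred1.
- by rewrite -gpredV invgM invgK.
- by rewrite -(mulgK y x^-1) -mulgA gpredM.
Qed.

Canonical coset_equiv := EquivRelPack coset_rel_equiv.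

Definition quotient_group : Type := {eq_quot coset_equiv}.

HB.instance Definition _ := Choice.on quotient_group.
HB.instance Definition _ := EqQuotient.on quotient_group.

Definition quot (x : G) : quotient_group := \pi_quotient_group x.

Definition quot_mul (a b : quotient_group) := quot (repr a * repr b).
Definition quot_one := quot 1.
Definition quot_inv (a : quotient_group) := quot (repr a)^-1.

Lemma quot_eqP x y : (quot x = quot y) <-> (x^-1 * y \in N).
Proof. by split=> [/eqP|xy]; [|apply/eqP]; rewrite /quot eqmodE. Qed.

Lemma quot_repr (a : quotient_group) : quot (repr a) = a.
Proof. exact: reprK. Qed.

Lemma repr_quot x : x^-1 * repr (quot x) \in N.
Proof. by apply/quot_eqP; rewrite quot_repr. Qed.

Lemma quot_mulE x y : quot_mul (quot x) (quot y) = quot (x * y).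
Proof.
apply/esym/quot_eqP; have := repr_quot y; have := repr_quot x.
set x' := repr _; set y' := repr _ => xx' yy'.
have -> : (x * y)^-1 * (x' * y') = (x^-1 * x') ^ y * (y^-1 * y').
  by rewrite conjgE invgM !mulgA mulgK.
by rewrite gpredM ?gpredJ_closed.
Qed.

Lemma quot_invE x : quot_inv (quot x) = quot x^-1.
Proof.
apply/esym/quot_eqP; have := repr_quot x; set x' := repr _ => xx'.
have -> : x^-1^-1 * x'^-1 = ((x^-1 * x') ^ x^-1)^-1.
  by rewrite conjgE invgK !mulgA mulgV mul1g invgM invgK.
by rewrite gpredV; apply: gpredJ_closed.
Qed.

Fact quot_mulA : associative quot_mul.
Proof.
move=> a b c; rewrite -(quot_repr a) -(quot_repr b) -(quot_repr c).
by rewrite !quot_mulE mulgA.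
Qed.

Fact quot_mul1 : left_id quot_one quot_mul.
Proof. by move=> a; rewrite -(quot_repr a) quot_mulE mul1g. Qed.

Fact quot_mulr1 : right_id quot_one quot_mul.
Proof. by move=> a; rewrite -(quot_repr a) quot_mulE mulg1. Qed.

Fact quot_mulV : left_inverse quot_one quot_inv quot_mul.
Proof. by move=> a; rewrite -(quot_repr a) quot_invE quot_mulE mulVg. Qed.

Fact quot_mulrV : right_inverse quot_one quot_inv quot_mul.
Proof. by move=> a; rewrite -(quot_repr a) quot_invE quot_mulE mulgV. Qed.

HB.instance Definition _ := isGroup.Build quotient_group
  quot_mulA quot_mul1 quot_mulr1 quot_mulV quot_mulrV.

Fact quotM : {morph quot : x y / x * y}.
Proof. by move=> x y; rewrite -quot_mulE. Qed.

HB.instance Definition _ := isMultiplicative.Build G quotient_group quot quotM.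
HB.instance Definition _ :=
  Multiplicative_isUMagmaMorphism.Build G quotient_group quot erefl.

End QuotientGroup.

Section NormalClosure.
Variables (G : groupType) (A : set G).

Definition normal_closure : {pred G} :=
  fun x => `[< forall N : normalClosed G, {subset A <= N} -> x \in N >].

Fact normal_closureM : mulg_closed normal_closure.
Proof.
move=> x y /asboolP xA /asboolP yA; apply/asboolP => N AN.
by rewrite gpredM ?xA ?yA.
Qed.

Fact normal_closure1 : 1 \in normal_closure.
Proof. by apply/asboolP => N _; exact: gpred1. Qed.

Fact normal_closureV : invg_closed normal_closure.
Proof. by move=> x /asboolP xA; apply/asboolP => N AN; rewrite gpredV xA. Qed.

Fact normal_closureJ (x y : G) :
  x \in normal_closure -> x ^ y \in normal_closure.
Proof.
by move=> /asboolP xA; apply/asboolP => N AN; rewrite gpredJ_closed ?xA.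
Qed.

HB.instance Definition _ := isMulClosed.Build G normal_closure normal_closureM.
HB.instance Definition _ := isMul1Closed.Build G normal_closure normal_closure1.
HB.instance Definition _ := isInvClosed.Build G normal_closure normal_closureV.
HB.instance Definition _ :=
  isNormalClosed.Build G normal_closure normal_closureJ.

End NormalClosure.

(* The values of [f] outside [X] are irrelevant: [f] stands for an arbitrary
   map from [X] to [K]. *)
Definition is_basis (F : groupType) (X : set F) : Prop :=
  forall (K : groupType) (f : F -> K),
    exists phi : {multiplicative F -> K},
      {in X, phi =1 f} /\
      forall psi : {multiplicative F -> K}, {in X, psi =1 f} -> psi =1 phi.

Definition is_free (F : groupType) : Prop := exists X : set F, is_basis X.

Definition is_cyclic (G : groupType) : Prop :=
  exists g : G, forall x : G, exists n : nat, x = g ^+ n \/ x = g ^- n.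

Definition maps_onto_noncyclic_free (G : groupType) : Prop :=
  exists (F : groupType) (f : {multiplicative G -> F}),
    [/\ is_free F, ~ is_cyclic F & forall y : F, exists x : G, f x = y].

Definition is_large (G : groupType) : Prop :=
  exists S : groupClosed G,
    finite_index S /\ maps_onto_noncyclic_free (subgroup_of S).

(* Main.v *)
(* A non-cyclic free group maps onto the free group E on [t] and [u], so it is
   enough to kill the [n]-th powers of finitely many elements [w <> 1] of E by a
   homomorphism onto E from a subgroup of finite index.  Unipotent matrices over
   Z/Q with Q = n / gcd(n, d!) give, for all large [n], a finite quotient J of E
   in which [w^n = 1] while [w] has large order, so that on J the powers [w^n]
   close up along few cycles.  Counting dimensions, some integer labelling [be]
   of the Schreier graph of J, not a coboundary, vanishes on all these cycles.
   As in the Baumslag-Pride theorem, pass to the cyclic cover J x Z/s given by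
   [be]: for large [s] there is again a non-coboundary labelling [al] vanishing
   on the cycles, now supported away from a fixed cut.  Label each edge by
   [u^al], times [t] to the number of times it crosses the cut.  A cycle of
   [w^n] is short compared with [s], so its label is trivial, while the labels of
   the loops at a suitable vertex include [u^k] with [k <> 0] and [u^x t u^y];
   after a last passage to a subgroup of finite index they generate E. *)
From HB Require Import structures.
From mathcomp Require Import all_boot all_order all_fingroup all_algebra.
From mathcomp Require Import boolp classical_sets cardinality zify ring.
Require Import Defs.

Set Implicit Arguments.
Unset Strict Implicit.
Unset Printing Implicit Defensive.

Import Algebra Order.TTheory GRing.Theory Num.Theory generic_quotient.
Local Open Scope group_scope.

(** * Wreath products and labelled Schreier graphs *)

Definition wreath (V : finType) (K : groupType) : Type :=
  ({perm V} * {ffun V -> K})%type.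

Section Wreath.
Variables (V : finType) (K : groupType).
Local Notation W := (wreath V K).

HB.instance Definition _ := Choice.on W.

Definition wreath_mul (p q : W) : W :=
  (p.1 * q.1, [ffun v => p.2 v * q.2 (p.1 v)]).
Definition wreath_one : W := (1, [ffun=> 1]).
Definition wreath_inv (p : W) : W :=
  (p.1^-1, [ffun v => (p.2 (p.1^-1 v))^-1]).

Fact wreath_mulA : associative wreath_mul.
Proof.
move=> p q r; congr (_, _); first exact: mulgA.
by apply/ffunP=> v; rewrite !ffunE /= permM mulgA.
Qed.

Fact wreath_mul1 : left_id wreath_one wreath_mul.
Proof.
case=> p f; congr (_, _); first exact: mul1g.
by apply/ffunP=> v; rewrite !ffunE /= mul1g perm1.
Qed.

Fact wreath_mulr1 : right_id wreath_one wreath_mul.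
Proof.
case=> p f; congr (_, _); first exact: mulg1.
by apply/ffunP=> v; rewrite !ffunE /= mulg1.
Qed.

Fact wreath_mulV : left_inverse wreath_one wreath_inv wreath_mul.
Proof.
case=> p f; congr (_, _); first exact: mulVg.
by apply/ffunP=> v; rewrite !ffunE /= mulVg.
Qed.

Fact wreath_mulrV : right_inverse wreath_one wreath_inv wreath_mul.
Proof.
case=> p f; congr (_, _); first exact: mulgV.
by apply/ffunP=> v; rewrite !ffunE /= permK mulgV.
Qed.

HB.instance Definition _ := isGroup.Build W
  wreath_mulA wreath_mul1 wreath_mulr1 wreath_mulV wreath_mulrV.

End Wreath.

(* The additive group of integers, in multiplicative notation. *)
Definition zgroup : Type := int.
HB.instance Definition _ := Choice.on zgroup.
HB.instance Definition _ := isGroup.Build zgroup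
  (@addrA int) (@add0r int) (@addr0 int) (@addNr int) (@addrN int).

Lemma zgroupM (x y : zgroup) : x * y = (x + y)%R. Proof. by []. Qed.

Lemma zgroupC (x y : zgroup) : x * y = y * x.
Proof. by rewrite !zgroupM addrC. Qed.

(* [E] is free on [a false] and [a true]; below these are [t] and [u]. *)
Definition free2 (E : groupType) (a : bool -> E) : Prop :=
  (forall (K : groupType) (f : bool -> K),
     exists2 phi : E -> K, {morph phi : x y / x * y} &
       forall b, phi (a b) = f b) /\
  (forall P : E -> Prop, P 1 -> (forall x y, P x -> P y -> P (x * y)) ->
     (forall x, P x -> P x^-1) -> (forall b, P (a b)) -> forall x, P x).

Lemma free2_hom (E : groupType) (a : bool -> E) (K : groupType) (f : bool -> K) :
  free2 a -> exists2 phi : E -> K, {morph phi : x y / x * y} &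
    forall b, phi (a b) = f b.
Proof. by case=> [+ _]; apply. Qed.

Section GroupMorphism.
Variables (G K : groupType) (f : G -> K).
Hypothesis fM : {morph f : x y / x * y}.

Lemma gmorph1 : f 1 = 1.
Proof. by apply: (mulgI (f 1)); rewrite -fM !mulg1. Qed.

Lemma gmorphV : {morph f : x / x^-1}.
Proof. by move=> x; apply: (mulgI (f x)); rewrite -fM !mulgV gmorph1. Qed.

Lemma gmorphX n : {morph f : x / x ^+ n}.
Proof. by elim: n => [|n IH] x; rewrite ?gmorph1 // !expgS fM IH. Qed.

End GroupMorphism.

(* [lab] records labels along paths in the Schreier graph of the right action
   [act]; on the stabiliser of [v] the map [lab^~ v] is a homomorphism. *)
Definition cocycle (E : groupType) (V : Type) (K : groupType)
    (act : E -> V -> V) (lab : E -> V -> K) : Prop :=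
  [/\ forall v, act 1 v = v,
      forall x y v, act (x * y) v = act y (act x v) &
      forall x y v, lab (x * y) v = lab x v * lab y (act x v)].

Section Cocycle.
Variables (E : groupType) (V : Type) (K : groupType).
Variables (act : E -> V -> V) (lab : E -> V -> K).
Hypothesis cal : cocycle act lab.

Lemma cocycle_act1 v : act 1 v = v. Proof. by case: cal. Qed.
Lemma cocycle_actM x y v : act (x * y) v = act y (act x v). Proof. by case: cal. Qed.
Lemma cocycle_labM x y v : lab (x * y) v = lab x v * lab y (act x v).
Proof. by case: cal. Qed.

Lemma cocycle_actK x : cancel (act x) (act x^-1).
Proof. by move=> v; rewrite -cocycle_actM mulgV cocycle_act1. Qed.

Lemma cocycle_actVK x : cancel (act x^-1) (act x).
Proof. by move=> v; rewrite -cocycle_actM mulVg cocycle_act1. Qed.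

Lemma cocycle_lab1 v : lab 1 v = 1.
Proof.
have := cocycle_labM 1 1 v; rewrite mulg1 cocycle_act1 -{1}[lab 1 v]mulg1.
by move/mulgI.
Qed.

Lemma cocycle_labV x v : lab x^-1 v = (lab x (act x^-1 v))^-1.
Proof.
apply: (mulIg (lab x (act x^-1 v))).
by rewrite -cocycle_labM mulVg cocycle_lab1 mulVg.
Qed.

Lemma cocycle_labJ x y v : (forall u, act x u = u) -> (forall u, lab x u = 1) ->
  act (x ^ y) v = v /\ lab (x ^ y) v = 1.
Proof.
move=> ax lx; rewrite conjgE; split; first by rewrite !cocycle_actM ax cocycle_actVK.
by rewrite !cocycle_labM lx ax mul1g -cocycle_labM mulVg cocycle_lab1.
Qed.

End Cocycle.

(** An action with labels in [K] is the same as a homomorphism to the wreath product of [K] with the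
    symmetric group on [V]; the universal property of E prescribes it on the generators. Products of
    permutations apply the left factor first, which gives right actions. *)
Lemma cocycle_exists (E : groupType) (a : bool -> E) (V : finType)
    (K : groupType) (s : bool -> {perm V}) (l : bool -> V -> K) :
  free2 a ->
  exists act lab, [/\ @cocycle E V K act lab,
    forall b v, act (a b) v = s b v & forall b v, lab (a b) v = l b v].
Proof.
move=> Ea.
have [phi phiM phia] :=
  free2_hom (fun b => (s b, [ffun v => l b v]) : wreath V K) Ea.
exists (fun e v => (phi e).1 v), (fun e v => (phi e).2 v).
split=> [|b v|b v]; [split=> [v|x y v|x y v] | by rewrite phia |].
- by rewrite (gmorph1 phiM) perm1.
- by rewrite phiM permM.
- by rewrite phiM ffunE.
by rewrite phia ffunE.
Qed.

Definition is_act (E : groupType) (V : Type) (act : E -> V -> V) : Prop :=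
  (forall v, act 1 v = v) /\ (forall x y v, act (x * y) v = act y (act x v)).

Lemma act_eq (E : groupType) (a : bool -> E) (V : Type)
    (act act' : E -> V -> V) :
  free2 a -> is_act act -> is_act act' ->
  (forall b v, act (a b) v = act' (a b) v) -> forall e v, act e v = act' e v.
Proof.
case=> _ Eind [a1 aM] [a1' aM'] aa'; apply: Eind => //.
- by move=> v; rewrite a1 a1'.
- by move=> x y IHx IHy v; rewrite aM aM' IHx IHy.
- move=> x IHx v; rewrite -{1}(a1' v) -(mulVg x) aM' -IHx -aM mulgV.
  exact: a1.
Qed.

(** * Integer powers and conditions on all large integers *)

Definition zpow (G : groupType) (x : G) (k : int) : G :=
  match k with Posz n => x ^+ n | Negz n => x ^- n.+1 end.

Section Zpow.
Variables (G : groupType) (x : G).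
Implicit Types j k : int.

Lemma zpowS k : zpow x (k + 1)%R = zpow x k * x.
Proof.
case: k => [n|[|n]].
- by rewrite -PoszD addn1 /= expgSr.
- by rewrite /= mulVg.
- have -> : (Negz n.+1 + 1 = Negz n)%R by rewrite !NegzE; lia.
  by rewrite /= [in RHS]expgS invgM mulgVK.
Qed.

Lemma zpow_pred k : zpow x (k - 1)%R = zpow x k * x^-1.
Proof. by apply: (mulIg x); rewrite -zpowS subrK mulgVK. Qed.

Lemma zpowD j k : zpow x (j + k)%R = zpow x j * zpow x k.
Proof.
elim/int_rect: k => [|n IH|n IH]; first by rewrite addr0 mulg1.
- by rewrite -addn1 PoszD addrA !zpowS IH mulgA.
- have -> : (- n.+1%:Z = - n%:Z - 1)%R by lia.
  by rewrite addrA !zpow_pred IH mulgA.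
Qed.

Lemma zpow0 : zpow x 0%R = 1. Proof. by []. Qed.

Lemma zpowN k : zpow x (- k)%R = (zpow x k)^-1.
Proof. by apply: (mulIg (zpow x k)); rewrite -zpowD addNr mulVg. Qed.

End Zpow.

Lemma gmorph_zpow (G K : groupType) (f : G -> K) x k :
  {morph f : x y / x * y} -> f (zpow x k) = zpow (f x) k.
Proof. by move=> fM; case: k => n /=; rewrite ?(gmorphV fM) (gmorphX fM). Qed.

Definition eventually_nat (P : nat -> Prop) : Prop :=
  exists N, forall n, N <= n -> P n.

Lemma eventually_all (T : eqType) (s : seq T) (P : T -> nat -> Prop) :
  (forall x, x \in s -> eventually_nat (P x)) ->
  eventually_nat (fun n => forall x, x \in s -> P x n).
Proof.
elim: s => [|x s IH] sP; first by exists 0%N.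
have [N NP] := sP x (mem_head _ _).
have [|N' N'P] := IH; first by move=> y ys; apply: sP; rewrite inE ys orbT.
exists (maxn N N') => n; rewrite geq_max => /andP[Nn N'n] y.
by rewrite inE => /predU1P[->|]; [exact: NP | exact: N'P].
Qed.

(** From [i * C(n, i) = n * C(n - 1, i - 1)] it follows that n divides [d! * C(n, i)]. After
    division by the gcd, the left side is coprime to what remains of [d!]. *)
Lemma dvdn_binomial n d i : 0 < i <= d -> n %/ gcdn n d`! %| 'C(n, i).
Proof.
case: i => // i /= id_; have g_gt0 : 0 < gcdn n d`! by rewrite gcdn_gt0 fact_gt0 orbT.
have nC : n %| d`! * 'C(n, i.+1).
  apply: (@dvdn_trans (i.+1 * 'C(n, i.+1))); last first.
    by apply: dvdn_mul => //; apply: dvdn_fact.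
  by rewrite -mul_bin_diag dvdn_mulr.
have cop : coprime (n %/ gcdn n d`!) (d`! %/ gcdn n d`!).
  rewrite /coprime -(eqn_pmul2r g_gt0) muln_gcdl.
  by rewrite !divnK ?dvdn_gcdl ?dvdn_gcdr // mul1n.
rewrite -(Gauss_dvdr _ cop) -(dvdn_pmul2r g_gt0).
by rewrite mulnAC !divnK ?dvdn_gcdl ?dvdn_gcdr.
Qed.

(** * Finite unipotent quotients *)

Section Unipotent.
Local Open Scope ring_scope.

Lemma unipotent_expn (R : nzRingType) (x : R) d n : x ^+ d.+1 = 0 ->
  (forall i, (0 < i <= d)%N -> 'C(n, i)%:R = 0 :> R) -> (x + 1) ^+ n = 1.
Proof.
move=> x0 C0; rewrite exprD1n big_ord_recl /= bin0 expr0 mulr1n big1 ?addr0 //.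
move=> i _; rewrite /bump /= add1n; have [id_|di] := leqP i.+1 d.
  by rewrite -mulr_natr C0 ?mulr0.
by rewrite -(subnKC di) exprD x0 mul0r mul0rn.
Qed.

(** Factoring [(x + 1)^m - 1] gives [x m = - x^2 T] for some T. Multiplying by [x^d] shows that
    [x^(d+2) = 0] forces [x^(d+1) m = 0], so the nilpotency exponent descends to 1. *)
Lemma unipotent_torsion_free (R : nzRingType) (x : R) d m :
  (forall y : R, y *+ m = 0 -> y = 0) -> x ^+ d.+1 = 0 -> (x + 1) ^+ m = 1 ->
  x = 0.
Proof.
move=> tf xd xm.
have [T xT] : exists T, x * m%:R + x ^+ 2 * T = 0.
  have powE i : exists T, (x + 1) ^+ i = 1 + x * T.
    exists (\sum_(j < i) (x + 1) ^+ j).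
    by rewrite -[X in X * _](addrK 1) -subrX1 [RHS]addrC subrK.
  have [T sumE] : exists T, \sum_(i < m) (x + 1) ^+ i = m%:R + x * T.
    have {}powE (i : 'I_m) := cid (powE i).
    exists (\sum_(i < m) projT1 (powE i)).
    rewrite mulr_sumr -[m in m%:R]card_ord -sumr_const -big_split /=.
    by apply: eq_bigr => i _; case: (powE i).
  exists T; rewrite expr2 -mulrA -mulrDr -sumE.
  by rewrite -[X in X * _](addrK 1) -subrX1 xm subrr.
elim: d xd => // d IH xd; apply: IH; apply: tf.
rewrite -mulr_natr exprSr -mulrA.
have -> : x * m%:R = - (x ^+ 2 * T) by apply/eqP; rewrite -addr_eq0 xT.
by rewrite mulrN mulrA -exprD addn2 xd mul0r oppr0.
Qed.

Section Bands.
Variables (R : nzRingType) (d : nat).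
Implicit Types A B : 'M[R]_d.+1.

(** The filtration by superdiagonals: [band 0] is upper triangular and [band 1] strictly upper
    triangular. *)
Definition band k A := forall i j : 'I_d.+1, (j < i + k)%N -> A i j = 0.

Lemma bandM k l A B : band k A -> band l B -> band (k + l) (A * B).
Proof.
move=> kA lB i j ij; rewrite mxE big1 // => h _.
have [hk|kh] := ltnP h (i + k); first by rewrite kA // mul0r.
by rewrite lB ?mulr0 //; lia.
Qed.

Lemma bandX k A n : band k A -> band (k * n) (A ^+ n).
Proof.
move=> kA; elim: n => [|n IH].
  move=> i j; rewrite muln0 addn0 expr0 !mxE; case: eqP => // ->.
  by rewrite ltnn.
by rewrite exprS mulnS; apply: bandM.
Qed.

Lemma band_nilpotent A : band 1 A -> A ^+ d.+1 = 0.
Proof.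
move=> /(@bandX _ _ d.+1) A0; apply/matrixP=> i j.
by rewrite A0 ?mxE //; case: j => j /=; lia.
Qed.

(* In a product of factors [1 + k_i N_(b_i)] with [N_b = parity_shift b] and
   alternating [b_i], the entry farthest from the diagonal is the product of the
   [k_i] (Magnus). *)
Definition parity_shift (b : bool) : 'M[R]_d.+1 :=
  \matrix_(i, j) ((j == i.+1 :> nat) && (odd i == b))%:R.

Lemma parity_shift_band b : band 1 (parity_shift b).
Proof. by move=> i j ij; rewrite mxE; case: eqP => //= ji; lia. Qed.

Lemma parity_shiftE b (A : 'M[R]_d.+1) (i j k : 'I_d.+1) :
  k = i.+1 :> nat -> (parity_shift b * A) i j = (odd i == b)%:R * A k j.
Proof.
move=> ki; rewrite mxE (bigD1 k) //= mxE ki eqxx big1 ?addr0 //= => h hk.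
rewrite mxE; case: eqP => [hi|_]; last by rewrite mul0r.
by move: hk; rewrite -val_eqE /= hi ki eqxx.
Qed.

Lemma parity_shiftE0 b (A : 'M[R]_d.+1) (i j : 'I_d.+1) :
  i = d :> nat -> (parity_shift b * A) i j = 0.
Proof.
move=> id_; rewrite mxE big1 // => h _; rewrite mxE.
case: eqP => [hi|_]; last by rewrite mul0r.
by have := ltn_ord h; rewrite hi id_ ltnn.
Qed.

Lemma parity_shift_sq b : parity_shift b * parity_shift b = 0.
Proof.
apply/matrixP=> i j; rewrite [RHS]mxE; have := ltn_ord i; rewrite ltnS leq_eqVlt.
case/predU1P=> [id_|id_]; first by rewrite parity_shiftE0.
rewrite (@parity_shiftE _ _ _ _ (Ordinal (id_ : i.+1 < d.+1)%N)) //.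
by rewrite mxE /=; case: (odd i) b => [] []; rewrite ?andbF ?mul0r ?mulr0.
Qed.

(** As the square of the shift vanishes, [1 - N] inverts [1 + N]. *)
Lemma parity_shift_inv b :
  (1 - parity_shift b) * (1 + parity_shift b) = 1 /\
  (1 + parity_shift b) * (1 - parity_shift b) = 1.
Proof.
by rewrite !(mulrDl, mulrDr, mulNr, mulrN) !mulr1 !mul1r parity_shift_sq oppr0
  !addr0 subrK addrK.
Qed.

End Bands.
End Unipotent.

(** * Reduced words and their unipotent matrices *)

Fixpoint syllables (E : groupType) (a : bool -> E) (b : bool) (ks : seq int) : E :=
  if ks is k :: ks' then zpow (a b) k * syllables a (~~ b) ks' else 1.

(** Left multiplication by a power of a generator keeps normal forms: it adds a syllable or merges
    with the first one, which disappears if the exponents cancel. Induction on [e] follows left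
    multiplication by [e] and by its inverse together. *)
Lemma syllable_form (E : groupType) (a : bool -> E) : free2 a ->
  forall e, exists b ks, all (predC1 0%R) ks /\ e = syllables a b ks.
Proof.
move=> [_ Eind] e.
pose nf e := exists b ks, all (predC1 0%R) ks /\ e = syllables a b ks.
have nf1 : nf 1 by exists true, [::].
have nf_pow b k z : nf z -> nf (zpow (a b) k * z).
  move=> [c [ks [ks0 ->]]]; have [->|k0] := eqVneq k 0%R.
    by rewrite zpow0 mul1g; exists c, ks.
  case: ks ks0 => [|j ks] /=.
    by move=> _; exists b, [:: k]; rewrite /= k0.
  case/andP=> j0 ks0; have [<-{c}|bc] := eqVneq b c; last first.
    exists b, [:: k, j & ks]; rewrite /= k0 j0; split=> //.
    by have -> : c = ~~ b by case: b c bc => [] [].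
  rewrite mulgA -zpowD; have [kj0|kj0] := eqVneq (k + j)%R 0%R.
    by rewrite kj0 zpow0 mul1g; exists (~~ b), ks.
  by exists b, ((k + j)%R :: ks); rewrite /= kj0.
suff P z : nf z -> nf (e * z) /\ nf (e^-1 * z) by have [] := P 1 nf1; rewrite mulg1.
elim/Eind: e z => [z|x y IHx IHy z|x IHx z|b z] nfz.
- by rewrite invg1 mul1g.
- rewrite invgM -!mulgA; split.
    by case: (IHy _ nfz) => /IHx[].
  by case: (IHx _ nfz) => _ /IHy[].
- by rewrite invgK; case: (IHx _ nfz).
- by split; [have := nf_pow b 1%R z nfz | have := nf_pow b (-1)%R z nfz].
Qed.

Section SyllableMatrix.
Local Open Scope ring_scope.
Variable d : nat.

Fixpoint syllable_mx (b : bool) (ks : seq int) : 'M[int]_d.+1 :=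
  if ks is k :: ks' then
    (1 + parity_shift int d b *~ k) * syllable_mx (~~ b) ks'
  else 1.

Lemma syllable_mxE k ks b (i j h : 'I_d.+1) : h = i.+1 :> nat ->
  syllable_mx b (k :: ks) i j =
  syllable_mx (~~ b) ks i j + k * (odd i == b)%:R * syllable_mx (~~ b) ks h j.
Proof.
move=> hi /=; rewrite mulrDl mul1r mxE mulrzAl -scaler_int intz mxE.
by rewrite (parity_shiftE _ _ _ hi) mulrA.
Qed.

Lemma syllable_mx_band b ks : band 1 (syllable_mx b ks - 1).
Proof.
elim: ks b => [|k ks IH] b; first by rewrite /= subrr => i j _; rewrite mxE.
rewrite /= mulrDl mul1r addrAC => i j ij; rewrite mxE IH // add0r.
have M0 : band 0 (syllable_mx (~~ b) ks).
  move=> h l hl; rewrite -[syllable_mx _ _](subrK 1) mxE IH; last by lia.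
  by rewrite mxE; case: eqP hl => // ->; rewrite addn0 ltnn.
rewrite mulrzAl -scaler_int mxE.
by rewrite (bandM (parity_shift_band _ b) M0) ?mulr0 // addn0.
Qed.

Lemma syllable_mx_far b ks (i j : 'I_d.+1) : (i + size ks < j)%N ->
  syllable_mx b ks i j = 0.
Proof.
elim: ks b i => [|k ks IH] b i ij.
  by rewrite mxE; case: eqP ij => // ->; rewrite addn0 ltnn.
have ij' : (i.+1 < d.+1)%N by move: ij (ltn_ord j) => /=; lia.
rewrite (syllable_mxE _ _ _ _ (erefl : Ordinal ij' = i.+1 :> nat)).
by rewrite !IH ?mulr0 ?addr0 //=; move: ij => /=; lia.
Qed.

(** To get from column i to column [i + size ks], every factor must contribute its shift. The parity
    of the index alternates along with the generators, provided that it starts at [b]. *)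
Lemma syllable_mx_corner b ks (i j : 'I_d.+1) : odd i = b ->
  j = (i + size ks)%N :> nat -> syllable_mx b ks i j = \prod_(k <- ks) k.
Proof.
elim: ks b i => [|k ks IH] b i ib ij.
  by rewrite big_nil mxE -val_eqE /= ij addn0 eqxx.
have ij' : (i.+1 < d.+1)%N by move: ij (ltn_ord j) => /=; lia.
rewrite (syllable_mxE _ _ _ _ (erefl : Ordinal ij' = i.+1 :> nat)).
rewrite syllable_mx_far ?add0r; last by move: ij => /=; lia.
rewrite big_cons ib eqxx mulr1 IH ?ib //=; move: ij => /=; lia.
Qed.

End SyllableMatrix.

Section UnipotentRepresentation.
Variables (Q d : nat).

Local Open Scope ring_scope.
Local Notation reduce := (map_mx (intr : int -> 'Z_Q)).

Lemma parity_shift_unit b : 1 + parity_shift 'Z_Q d b \is a GRing.unit.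
Proof.
have [l r] := parity_shift_inv 'Z_Q d b.
by apply/unitrP; exists (1 - parity_shift _ d b).
Qed.

Definition parity_unit b : {'GL_d.+1['Z_Q]} :=
  FinRing.unit 'M['Z_Q]_d.+1 (parity_shift_unit b).

Lemma reduce_parity_shift b :
  reduce (parity_shift int d b) = parity_shift 'Z_Q d b.
Proof. by apply/matrixP=> i j; rewrite !mxE; case: andP. Qed.

Lemma val_parity_zpow b k :
  val (zpow (parity_unit b) k) = reduce (1 + parity_shift int d b *~ k).
Proof.
rewrite rmorphD rmorph1 rmorphMz /= reduce_parity_shift.
set N := parity_shift _ d b; have N0 : N * N = 0 := parity_shift_sq _ d b.
have valE : val (parity_unit b) = 1 + N by [].
have XnE n : (1 + N) ^+ n = 1 + N *+ n.
  elim: n => [|n IH]; first by rewrite mulr0n addr0.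
  by rewrite exprS IH mulrDl mul1r mulrDr mulr1 mulrnAr N0 mul0rn addr0 mulrSr addrA.
case: k => n; first by rewrite /= FinRing.val_unitX valE XnE.
have -> : val (zpow (parity_unit b) (Negz n)) = (val (parity_unit b ^+ n.+1)%g)^-1.
  by [].
rewrite NegzE mulrNz FinRing.val_unitX valE.
apply: (@mulrI _ ((1 + N) ^+ n.+1)); first by rewrite unitrX ?parity_shift_unit.
rewrite mulrV ?unitrX ?parity_shift_unit // XnE -pmulrn.
rewrite mulrDl mul1r mulrDr mulr1 mulrN mulrnAr mulrnAl N0 !mul0rn oppr0 addr0.
by rewrite subrK.
Qed.

Lemma val_syllables b ks :
  val (syllables parity_unit b ks) = reduce (syllable_mx d b ks).
Proof.
elim: ks b => [|k ks IH] b /=; first by rewrite map_mx1.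
by rewrite val_parity_zpow IH map_mxM.
Qed.

End UnipotentRepresentation.

(** Cutting the target down to the image makes the translation action of E on it transitive. *)
Lemma finite_group_image (E : groupType) (G : finGroupType) (f : E -> G) :
  {morph f : x y / x * y} ->
  exists (I : finGroupType) (h : E -> I), [/\ {morph h : x y / x * y},
    forall y, exists x, h x = y & forall x, h x = 1 <-> f x = 1].
Proof.
move=> fM; pose im := [set z | `[< exists x, f x = z >]]%SET.
have imP z : reflect (exists x, f x = z) (z \in im).
  by rewrite inE; apply: asboolP.
have im_group : group_set im.
  apply/group_setP; split=> [|y z].
    by apply/imP; exists 1; exact: (gmorph1 fM).
  move=> /imP[x <-] /imP[x' <-].
  by apply/imP; exists (x * x'); rewrite fM.
pose H := Group im_group.
have fH x : f x \in H by apply/imP; exists x.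
exists (subg_of H : finGroupType), (fun x => subg H (f x)); split=> [x y|y|x].
- by rewrite fM subgM.
- have := subgP y; move=> /imP[x fx]; exists x.
  by rewrite fx sgvalK.
- split=> [/(congr1 sgval)|->]; first by rewrite subgK ?sgval1.
  by apply: val_inj; rewrite /= subgK.
Qed.

Lemma intr_Zp_eq0 Q (z : int) : 1 < Q -> (z%:~R = 0 :> 'Z_Q)%R -> Q %| absz z.
Proof.
move=> Q1 z0; have {}z0 : ((absz z)%:R = 0 :> 'Z_Q)%R.
  case: (intP z) z0 => [|n|n] //; rewrite abszN mulrNz => /eqP.
  by rewrite oppr_eq0 => /eqP.
move/(congr1 val): z0; rewrite /= val_Zp_nat // => z0.
by rewrite /dvdn z0.
Qed.

Section UnipotentQuotients.
Local Open Scope ring_scope.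

(** Over the integers [S ^+ m] is not 1, since unipotent matrices have no torsion. A nonzero entry z
    of [S ^+ m - 1] survives modulo every Q greater than |z|; the bound also ensures [1 < Q]. *)
Lemma reduce_unipotent_neq1 d (S : 'M[int]_d.+1) m : band 1 (S - 1) -> S != 1 ->
  (0 < m)%N ->
  eventually_nat (fun Q => map_mx (intr : int -> 'Z_Q) S ^+ m <> 1).
Proof.
move=> bS S1 m0; have Sm : S ^+ m - 1 != 0.
  apply: contra_neq S1 => /eqP; rewrite subr_eq0 => /eqP Sm.
  apply/eqP; rewrite -subr_eq0; apply/eqP.
  apply: (@unipotent_torsion_free _ _ d m); last by rewrite subrK.
    move=> A /matrixP Am; apply/matrixP=> i j; apply/eqP.
    by have /eqP := Am i j; rewrite !mxE mulmxnE mulrn_eq0 (gtn_eqF m0).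
  exact: band_nilpotent.
have [i [j Sij]] : exists i j, (S ^+ m - 1) i j != 0.
  apply: contrapT => S0; case/eqP: Sm; apply/matrixP=> i j; rewrite [RHS]mxE.
  by apply: contrapT => /eqP Sij; apply: S0; exists i, j.
set z := (S ^+ m - 1) i j in Sij; exists (absz z).+2 => Q QN Sm1.
have : z%:~R = 0 :> 'Z_Q.
  have /matrixP/(_ i j) : map_mx (intr : int -> 'Z_Q) (S ^+ m - 1) = 0.
    by rewrite rmorphB rmorphXn rmorph1 /= Sm1 subrr.
  by rewrite [in RHS]mxE => <-; rewrite mxE.
by move/intr_Zp_eq0 => /(_ ltac:(lia)) /dvdn_leq; move: Sij; lia.
Qed.

Lemma reduce_unipotent_expn Q d (S : 'M[int]_d.+1) n : (1 < Q)%N ->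
  band 1 (S - 1) -> (forall i, (0 < i <= d)%N -> (Q %| 'C(n, i))%N) ->
  map_mx (intr : int -> 'Z_Q) S ^+ n = 1.
Proof.
move=> Q1 bS QC; rewrite -[S](subrK 1) rmorphD rmorph1.
apply: (@unipotent_expn _ _ d).
  by rewrite -rmorphXn (band_nilpotent bS) rmorph0.
move=> i /QC/dvdnP[c ->]; rewrite natrM.
suff -> : Q%:R = 0 :> 'M['Z_Q]_d.+1 by rewrite mulr0.
by rewrite -scaler_nat pchar_Zp // scale0r.
Qed.

End UnipotentQuotients.

Lemma unipotent_quotients (E : groupType) (a : bool -> E) (W : seq E) M :
  free2 a -> (forall w, w \in W -> w <> 1) ->
  eventually_nat (fun n => exists (I : finGroupType) (rho : E -> I),
    [/\ {morph rho : x y / x * y}, forall y, exists x, rho x = y &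
      forall w, w \in W -> rho w ^+ n = 1 /\
        forall m, 0 < m < M -> rho w ^+ m <> 1]).
Proof.
move=> Ea W1.
have [d [S SP]] : exists d (S : E -> 'M[int]_d.+1), forall w, w \in W ->
    exists b ks, [/\ w = syllables a b ks, S w = syllable_mx d b ks & S w != 1%R].
  (* One matrix size serves all words of [W]: it only has to leave room for the corner entry, in row
     [b] and column [b + size ks], which is a product of nonzero exponents. *)
  have [d dP] : eventually_nat (fun d => forall w, w \in W -> exists b ks,
      w = syllables a b ks /\ syllable_mx d b ks != 1%R).
    apply: eventually_all => w /W1 w1.
    have [b [ks [ks0 wE]]] := syllable_form Ea w.
    exists (size ks).+1 => d dks; exists b, ks; split=> //.
    have bd : b < d.+1 by rewrite ltnS (leq_trans (leq_b1 b)) // (leq_trans _ dks).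
    have kd : b + size ks < d.+1.
      by rewrite ltnS (leq_trans _ dks) // -add1n leq_add2r leq_b1.
    apply/eqP => /matrixP/(_ (Ordinal bd) (Ordinal kd)).
    rewrite (@syllable_mx_corner _ b) ?oddb // mxE -val_eqE /=.
    case: ks ks0 wE {dks kd} => [|k ks] ks0 wE; first by [].
    rewrite -{1}(addn0 b) eqn_add2l /= => /eqP.
    by rewrite prodf_seq_eq0 => /hasP[j /(allP ks0)/negPf /=->].
  suff /choice[S SP] : forall w, exists S : 'M[int]_d.+1, w \in W ->
      exists b ks, [/\ w = syllables a b ks, S = syllable_mx d b ks & S != 1%R].
    by exists d, S.
  move=> w; have [wW|wW] := pselect (w \in W); last by exists 0%R => /wW.
  by have [b [ks [wE S1]]] := dP d (leqnn d) w wW; exists (syllable_mx d b ks), b, ks.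
have [Q0 Q0P] : eventually_nat (fun Q => forall w, w \in W ->
    forall m, m \in iota 1 M.-1 ->
    (map_mx (intr : int -> 'Z_Q) (S w) ^+ m <> 1)%R).
  apply: eventually_all => w /SP[b [ks [wE SE S1]]].
  apply: eventually_all => m; rewrite mem_iota => mM.
  by apply: reduce_unipotent_neq1 => //; [rewrite SE; exact: syllable_mx_band | lia].
(* The gcd is at most [d!], so this bound on n makes Q at least [Q0 + 2], while Q still divides the
   binomial coefficients that must vanish. *)
exists (Q0.+2 * d`!)%N => n nQ; pose Q := n %/ gcdn n d`!.
have QQ0 : Q0.+2 <= Q.
  rewrite leq_divRL ?gcdn_gt0 ?fact_gt0 ?orbT //; apply: leq_trans nQ.
  by rewrite leq_mul2l dvdn_leq ?fact_gt0 ?dvdn_gcdr ?orbT.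
have Q1 : 1 < Q by lia.
have [f fM fa] := free2_hom (parity_unit Q d) Ea.
have [I [h [hM h_onto h1]]] := finite_group_image fM.
exists I, h; split=> // w wW; have [b [ks [wE SE S1]]] := SP w wW.
have valX m : val (f w ^+ m) = (map_mx (intr : int -> 'Z_Q) (S w) ^+ m)%R.
  rewrite FinRing.val_unitX SE -(val_syllables Q d) wE; congr (val _ ^+ m)%R.
  elim: (ks) (b) => [|k l IH] c /=; first exact: (gmorph1 fM).
  by rewrite fM (gmorph_zpow _ _ fM) fa IH.
have hX m : h w ^+ m = 1 <-> (map_mx (intr : int -> 'Z_Q) (S w) ^+ m = 1)%R.
  rewrite -valX -(gmorphX hM) h1 (gmorphX fM); split=> [->//|fw].
  exact: val_inj.
split.
  apply/hX/(@reduce_unipotent_expn _ d) => //.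
    by rewrite SE; exact: syllable_mx_band.
  by move=> i id_; apply: dvdn_binomial.
move=> m mM /hX; apply: Q0P => //; first by lia.
by rewrite mem_iota; lia.
Qed.

(** * Labellings vanishing on the relators *)

Section IntegralSolutions.
Local Open Scope ring_scope.

Lemma clear_denominators n (r : 'rV[rat]_n) :
  exists2 D : int, D != 0 & exists s : 'I_n -> int,
    forall j, (s j)%:~R = D%:~R * r 0 j :> rat.
Proof.
exists (\prod_j denq (r 0 j)); first by apply/prodf_neq0 => j _; exact: denq_neq0.
exists (fun j => (\prod_(i | i != j) denq (r 0 i)) * numq (r 0 j)) => j.
rewrite [in RHS](bigD1 j) //= !rmorphM /= numqE; ring.
Qed.

(* The solutions supported on [S] of the equations [ks] form a space of dimension
   at least [#|S| - size ks], more than the dimension of the span of the [B v]. *)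
Lemma integral_solution (T : finType) (S : {set T}) (ks : seq (T -> int))
    (V : finType) (B : V -> T -> int) :
  (size ks + #|V| < #|S|)%N ->
  exists al : T -> int, [/\ forall e, e \notin S -> al e = 0,
    forall k, k \in ks -> \sum_e k e * al e = 0 &
    forall f : V -> int, exists2 e, e \in S & al e != \sum_v f v * B v e].
Proof.
move=> lt_card; set n := #|S|.
pose K : 'M[rat]_(n, size ks) :=
  \matrix_(i, j) (nth (fun=> 0) ks j (enum_val i))%:~R.
pose C : 'M[rat]_(#|V|, n) := \matrix_(v, i) (B (enum_val v) (enum_val i))%:~R.
(* The kernel of [K] has rank at least [n - size ks], which exceeds the rank of [C], so some row of
   the kernel matrix is outside the row space of [C]. *)
have /row_subPn[i kiC] : ~~ (kermx K <= C)%MS.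
  apply/negP => /mxrankS; rewrite mxrank_ker => rk.
  have := rank_leq_row C; have := rank_leq_col K; move: rk lt_card.
  by rewrite -/n; lia.
set r := row i (kermx K) in kiC.
have rK : r *m K = 0 by rewrite -row_mul mulmx_ker row0.
clearbody r; have [D D0 [s sE]] := clear_denominators r.
(* The integral multiple of [r], extended by 0 outside [S]. *)
pose al e := if [pick j | enum_val j == e] is Some j then s (j : 'I_n) else 0.
have alE (j : 'I_n) : al (enum_val j) = s j.
  rewrite /al; case: pickP => [h /eqP/enum_val_inj->//|/(_ j)].
  by rewrite eqxx.
have al0 e : e \notin S -> al e = 0.
  rewrite /al; case: pickP => // j /eqP<-.
  by rewrite enum_valP.
have sum_al (F : T -> int) : \sum_e F e * al e = \sum_(j < n) F (enum_val j) * s j.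
  rewrite (bigID (mem S)) /= [X in _ + X]big1 => [|e /al0->]; last by rewrite mulr0.
  by rewrite addr0 big_enum_val; apply: eq_bigr => j _; rewrite alE.
exists al; split=> // [k kin|f].
  have [c ck ->] : exists2 c, (c < size ks)%N & k = nth (fun=> 0) ks c.
    by have [c ck <-] := (nthP (fun=> 0) kin); exists c.
  rewrite sum_al; apply: (@intr_inj rat); rewrite rmorph_sum /=.
  have /matrixP/(_ 0 (Ordinal ck)) := rK; rewrite mxE [RHS]mxE => rK0.
  rewrite [RHS](_ : _ = D%:~R * 0); last by rewrite mulr0.
  rewrite -[X in _ = _ * X]rK0 mulr_sumr; apply: eq_bigr => j _.
  rewrite rmorphM /= sE [K _ _]mxE /=; ring.
apply: contrapT => alf; case/negP: kiC.
pose u : 'rV[rat]_#|V| := \row_v (f (enum_val v))%:~R.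
have D0' : D%:~R != 0 :> rat by rewrite intr_eq0.
have -> : r = D%:~R^-1 *: (u *m C).
  apply/rowP=> j; rewrite mxE; apply: (mulfI D0'); rewrite -sE mulVKf // mxE.
  have -> : s j = \sum_v f v * B v (enum_val j).
    rewrite -alE; apply/eqP; apply: contrapT => /negP sj; apply: alf.
    by exists (enum_val j) => //; exact: enum_valP.
  rewrite rmorph_sum (reindex _ (onW_bij _ (@enum_val_bij V))) /=.
  apply: eq_bigr => v _.
  by rewrite !mxE rmorphM.
by rewrite scalemx_sub ?submxMl.
Qed.

End IntegralSolutions.

(** [P v w k] stands for a path from v to w of total label k. If all loops have label 0, the label
    of a path depends only on its ends, and [f v] is the label from a root chosen in the component
    of v. *)
Lemma integral_potential (V : finType) (P : V -> V -> int -> Prop) :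
  (forall v, P v v 0%R) -> (forall v w k, P v w k -> P w v (- k)%R) ->
  (forall u v w j k, P u v j -> P v w k -> P u w (j + k)%R) ->
  (forall v k, P v v k -> k = 0%R) ->
  exists f : V -> int, forall v w k, P v w k -> k = (f w - f v)%R.
Proof.
move=> Prefl Psym Ptrans Ploop.
pose conn w v := `[< exists k, P w v k >].
pose root v := odflt v [pick w | conn w v].
have rootP v : exists k, P (root v) v k.
  rewrite /root; case: pickP => [w /asboolP//|_].
  by exists 0%R.
have [f fP] := choice rootP.
exists f => v w k Pvw.
have rvw : root v = root w.
  rewrite /root; have cvw : conn^~ v =1 conn^~ w.
    move=> u; apply/asboolP/asboolP => -[j Pj].
      by exists (j + k)%R; exact: Ptrans Pvw.
    by exists (j - k)%R; apply: Ptrans Pj _; exact: Psym.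
  rewrite -(eq_pick cvw); case: pickP => //= /(_ v)/asboolP[].
  by exists 0%R.
have := fP v; rewrite rvw => Pv.
have /Ploop : P w w (- f w + (f v + k))%R.
  by apply: Ptrans (Ptrans _ _ _ _ _ Pv Pvw); apply: Psym; exact: fP.
by lia.
Qed.

(** Every cycle has at least [M] points, so there are at most [#|V| / M] cycles. *)
Lemma orbit_representatives (V : finType) (s : {perm V}) M :
  (forall v m, 0 < m < M -> (s ^+ m) v <> v) ->
  exists2 T : seq V, M * size T <= #|V| & forall v, exists2 r, r \in T &
    exists k, v = (s ^+ k) r.
Proof.
move=> sfree; have porbitE x : orbit 'P <[s]> x = porbit s x by rewrite porbit.unlock.
pose orbs := [set orbit 'P <[s]> x | x in [set: V]]%SET.
have sum_orbs : \sum_(O in orbs) #|O| = #|V|.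
  by rewrite acts_sum_card_orbit ?cardsT //; apply/actsP=> x _ y; rewrite !inE.
exists (pmap (fun O : {set V} => [pick v in O]) (enum orbs)).
  rewrite -sum_orbs size_pmap (leq_trans (n := M * #|orbs|)) //.
    by rewrite leq_mul2l cardE count_size orbT.
  rewrite mulnC -sum_nat_const; apply: leq_sum => _ /imsetP[x _ ->].
  rewrite leqNgt porbitE; apply/negP => lt_M.
  apply: (sfree x #|porbit s x|); last by rewrite permX iter_porbit.
  by rewrite lt0n card_porbit_neq0.
move=> v; case def_r: [pick r in porbit s v] => [r|]; last first.
  by move: def_r; case: pickP => // /(_ v); rewrite porbit_id.
exists r.
  rewrite mem_pmap; apply/mapP; exists (porbit s v) => //.
  by rewrite mem_enum -porbitE; apply/imsetP; exists v; rewrite ?inE.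
move: def_r; case: pickP => // x vx [xr]; move: vx; rewrite xr porbit_sym.
by case/porbitP => k ->; exists k.
Qed.

Section Labellings.
Variables (E : groupType) (a : bool -> E) (V : finType) (act : E -> V -> V).
Hypotheses (Ea : free2 a) (actP : is_act act).

Lemma cocycle_extend (K : groupType) (l : bool -> V -> K) :
  exists2 lab, cocycle act lab & forall b v, lab (a b) v = l b v.
Proof.
have [act1 actM] := actP.
have act_inj x : injective (act x).
  by apply: (can_inj (g := act x^-1)) => v; rewrite -actM mulgV.
have [act' [lab [al act'a laba]]] :=
  cocycle_exists (fun b => perm (@act_inj (a b))) l Ea.
exists lab => //; suff -> : act = act' by [].
apply: funext => e; apply: funext => v; apply: (act_eq Ea) => //.
  by split; [exact: cocycle_act1 al | exact: cocycle_actM al].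
by move=> b u; rewrite act'a permE.
Qed.

(** The coefficient [k i] is the signed number of times that the path of [e] from [v] runs through
    the edge [i]. It is independent of [lab], so vanishing of a label is a linear equation in the
    edge labels. *)
Lemma linear_label e v : exists k : bool * V -> int,
  forall lab : E -> V -> zgroup, cocycle act lab ->
  lab e v = (\sum_i k i * lab (a i.1) i.2)%R.
Proof.
case: Ea => _ Eind; elim/Eind: e v => [v|x y IHx IHy v|x IHx v|b v].
- exists (fun=> 0%R) => lab al; rewrite (cocycle_lab1 al) big1 // => i _.
  by rewrite mul0r.
- have [kx kxE] := IHx v; have [ky kyE] := IHy (act x v).
  exists (fun i => (kx i + ky i)%R) => lab al; rewrite (cocycle_labM al).
  rewrite (kxE _ al) (kyE _ al) -[LHS]big_split /=.
  by apply: eq_bigr => i _; rewrite mulrDl.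
- have [k kE] := IHx (act x^-1 v); exists (fun i => (- k i)%R) => lab al.
  rewrite (cocycle_labV al) (kE _ al) -[LHS]sumrN.
  by apply: eq_bigr => i _; rewrite mulNr.
- exists (fun i => (i == (b, v))%:R%R) => lab al.
  by rewrite (bigD1 (b, v)) //= eqxx mul1r big1 ?addr0 // => i /negPf->; rewrite mul0r.
Qed.

(* [lab (w ^+ n)] is constant on the orbits of [w], which have at least [M]
   points, so one equation per orbit suffices. *)
Lemma power_equations w n M :
  (forall v, act (w ^+ n) v = v) ->
  (forall v m, 0 < m < M -> act (w ^+ m) v <> v) ->
  exists2 ks : seq (bool * V -> int), M * size ks <= #|V| &
    forall lab : E -> V -> zgroup, cocycle act lab ->
    (forall k, k \in ks -> (\sum_i k i * lab (a i.1) i.2 = 0)%R) ->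
    forall v, lab (w ^+ n) v = 0%R.
Proof.
have [act1 actM] := actP => actn actm.
have act_inj : injective (act w).
  by apply: (can_inj (g := act w^-1)) => v; rewrite -actM mulgV.
have permXE m v : (perm act_inj ^+ m) v = act (w ^+ m) v.
  elim: m => [|m IH]; first by rewrite perm1 act1.
  by rewrite !expgSr permM permE actM IH.
have [|T sizeT Tonto] := @orbit_representatives _ (perm act_inj) M.
  by move=> v m mM; rewrite permXE; exact: actm.
have [k kE] := choice (linear_label (w ^+ n)).
exists (map k T); first by rewrite size_map.
move=> lab al lab0.
(* Expand the label of [w ^+ n.+1] at v in two ways; as [w ^+ n] fixes v, the common term [lab w v]
   cancels in the commutative group of labels. *)
have labw v : lab (w ^+ n) (act w v) = lab (w ^+ n) v.
  have := cocycle_labM al w (w ^+ n) v; rewrite -expgS expgSr.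
  by rewrite (cocycle_labM al) actn [RHS]zgroupC => /mulIg.
move=> v; have [r rT [m ->]] := Tonto v; rewrite permXE.
elim: m => [|m IH]; last by rewrite expgSr actM labw.
by rewrite act1 (kE _ _ al) lab0 // map_f.
Qed.

(** The unknowns are the labels of the [2 * #|A|] edges that start in [A]. The relators give at most
    [size W * #|V| / M] equations and the coboundaries span at most [#|V|] dimensions, so the
    inequality leaves a solution that is not a coboundary. *)
Lemma relator_labelling (W : seq E) n M (A : {set V}) :
  (forall w v, w \in W -> act (w ^+ n) v = v) ->
  (forall w v m, w \in W -> 0 < m < M -> act (w ^+ m) v <> v) ->
  size W * #|V| + M * #|V| < M * (2 * #|A|) ->
  exists lab : E -> V -> zgroup, [/\ cocycle act lab,
    forall b v, v \notin A -> lab (a b) v = 0%R,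
    forall w v, w \in W -> lab (w ^+ n) v = 0%R &
    forall f : V -> int, exists b v,
      v \in A /\ lab (a b) v <> (f (act (a b) v) - f v)%R].
Proof.
move=> Wn Wm ltA; have [ks size_ks ksW] : exists2 ks : seq (bool * V -> int),
    M * size ks <= size W * #|V| & forall lab : E -> V -> zgroup,
    cocycle act lab ->
    (forall k, k \in ks -> (\sum_i k i * lab (a i.1) i.2 = 0)%R) ->
    forall w v, w \in W -> lab (w ^+ n) v = 0%R.
  elim: W Wn Wm {ltA} => [|w W IH] Wn Wm; first by exists [::]; rewrite ?muln0.
  have [||ks size_ks ksW] := IH.
  - by move=> x v xW; apply: Wn; rewrite inE xW orbT.
  - by move=> x v m xW; apply: Wm; rewrite inE xW orbT.
  have [||ks' size_ks' ksw] := @power_equations w n M.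
  - by move=> v; apply: Wn; rewrite mem_head.
  - by move=> v m; apply: Wm; rewrite mem_head.
  exists (ks' ++ ks); first by rewrite size_cat mulnDr mulSn leq_add.
  move=> lab al kslab x v; rewrite inE => /predU1P[->|xW].
    by apply: ksw => // k kin; apply: kslab; rewrite mem_cat kin.
  by apply: ksW => // k kin; apply: kslab; rewrite mem_cat kin orbT.
pose S := [set i : bool * V | i.2 \in A].
have cardS : #|S| = (2 * #|A|)%N.
  rewrite -card_bool -[#|A|]cardsE -cardsT -cardsX; apply: eq_card => -[b v].
  by rewrite !inE.
(* The coboundary of the indicator function of v. *)
pose B v (i : bool * V) : int := ((v == act (a i.1) i.2)%:R - (v == i.2)%:R)%R.
have [|al [alS alks alB]] := @integral_solution _ S ks V B.
  have : M * (size ks + #|V|) < M * #|S|.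
    by rewrite cardS mulnDr; apply: leq_ltn_trans ltA; rewrite leq_add2r.
  by rewrite ltn_mul2l => /andP[].
have [lab labP laba] := cocycle_extend (K := zgroup) (fun b v => al (b, v)).
exists lab; split=> // [b v vA|w v wW|f].
- by rewrite laba alS // inE.
- apply: ksW => // k kin; rewrite -[RHS](alks k kin); apply: eq_bigr => -[b u] _.
  by rewrite laba.
- have [[b v]] := alB f; rewrite inE => vA /eqP alv; exists b, v; split=> //.
  rewrite laba => alE; apply: alv; rewrite alE.
  under eq_bigr do rewrite /B mulrBr.
  rewrite sumrB (bigD1 (act (a b) v)) //= eqxx mulr1 big1 ?addr0; last first.
    by move=> u /negPf->; rewrite mulr0.
  rewrite (bigD1 v) //= eqxx mulr1 big1 ?addr0 // => u /negPf->.
  by rewrite mulr0.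
Qed.

(** If all loops had label 0, the labelling would be the coboundary of a potential. A loop of
    negative label is inverted. *)
Lemma relator_loop (W : seq E) n M :
  (forall w v, w \in W -> act (w ^+ n) v = v) ->
  (forall w v m, w \in W -> 0 < m < M -> act (w ^+ m) v <> v) ->
  size W < M -> 0 < #|V| ->
  exists lab : E -> V -> zgroup, [/\ cocycle act lab,
    forall w v, w \in W -> lab (w ^+ n) v = 0%R &
    exists e v, act e v = v /\ (0 < lab e v)%R].
Proof.
move=> Wn Wm WM V0; have [|lab [labP _ labW labf]] :=
    relator_labelling Wn Wm (A := [set: V]%SET).
  by rewrite cardsT; nia.
exists lab; split=> //; apply: contrapT => no_loop.
have [||||f fP] := @integral_potential V
  (fun v w k => exists2 e, act e v = w & lab e v = k).
- by move=> v; exists 1; [exact: (cocycle_act1 labP) | exact: (cocycle_lab1 labP)].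
- move=> v w k [e <- <-]; exists e^-1; first exact: (cocycle_actK labP).
  by rewrite (cocycle_labV labP) (cocycle_actK labP).
- move=> u v w j k [e <- <-] [e' <- <-]; exists (e * e').
    exact: (cocycle_actM labP).
  exact: (cocycle_labM labP).
- move=> v k [e ev <-]; apply: contrapT => k0; apply: no_loop.
  have [k_gt0|k_le0] := ltP 0%R (lab e v : int); first by exists e, v.
  exists e^-1, v; rewrite (cocycle_labV labP).
  have eV : act e^-1 v = v by rewrite -{1}ev (cocycle_actK labP).
  split=> //; rewrite eV; change (0 < - (lab e v : int))%R; lia.
- by have [b [v [_]]] := labf f; apply; apply: fP; exists (a b).
Qed.

End Labellings.

(** * The cyclic cover *)

Section CyclicCover.
Variables (E : groupType) (J : finType) (act : E -> J -> J).
Variable be : E -> J -> zgroup.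
Hypothesis beP : cocycle act be.
Variable s : nat.
Local Open Scope ring_scope.

Definition level (z : int) : 'I_s.+1 := inord (absz (z %% s.+1)%Z).

Lemma levelE z : (level z : nat)%:Z = (z %% s.+1)%Z.
Proof.
have ge0 : (0 <= z %% s.+1)%Z by apply: modz_ge0.
have lt : (z %% s.+1 < s.+1)%Z by apply: ltz_pmod.
by rewrite inordK ?gez0_abs //; lia.
Qed.

Definition cover_shift e (p : J * 'I_s.+1) : int := p.2%:Z + (be e p.1 : int).
Definition cover_act e p : J * 'I_s.+1 := (act e p.1, level (cover_shift e p)).
(** The lifted path runs from the integer [p.2] to [cover_shift e p]; its winding is the signed
    number of times it crosses the cut between the levels s and 0. *)
Definition winding e p : zgroup := (cover_shift e p %/ s.+1)%Z.

Lemma cover_shiftE e p : cover_shift e p =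
  (winding e p : int) * s.+1%:Z + ((cover_act e p).2 : nat)%:Z.
Proof. by rewrite levelE -divz_eq. Qed.

Lemma euclid_unique (q q' r r' : int) : q * s.+1%:Z + r = q' * s.+1%:Z + r' ->
  0 <= r < s.+1%:Z -> 0 <= r' < s.+1%:Z -> q = q' /\ r = r'.
Proof.
move=> eq_qr r_s r'_s; suff qq' : q = q' by move: eq_qr; rewrite qq'; lia.
by nia.
Qed.

Lemma level_unique (q z : int) (l : 'I_s.+1) : z = q * s.+1%:Z + l%:Z ->
  level z = l /\ (z %/ s.+1)%Z = q.
Proof.
move=> zE; have := divz_eq z s.+1; rewrite -levelE {1}zE => /euclid_unique.
have := ltn_ord l; have := ltn_ord (level z) => lt1 lt2 [] //; try lia.
by move=> <- /eqP; rewrite eqz_nat => /eqP/val_inj <-.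
Qed.

(** Lifted shifts add along a product. Uniqueness of Euclidean division then handles both parts:
    remainders give the action, quotients the additivity of the winding. *)
Lemma cover_cocycle : cocycle cover_act winding.
Proof.
have add x y v : (be (x * y)%g v : int) = be x v + be y (act x v).
  exact: (cocycle_labM beP).
have one v : (be 1%g v : int) = 0 by exact: (cocycle_lab1 beP).
have M x y p : level (cover_shift (x * y)%g p) =
      level (cover_shift y (cover_act x p)) /\
    ((cover_shift (x * y)%g p) %/ s.+1)%Z =
      (winding x p : int) + (winding y (cover_act x p) : int).
  have := cover_shiftE x p; have := cover_shiftE y (cover_act x p).
  have shiftE : cover_shift (x * y)%g p =
      cover_shift x p + (be y (act x p.1) : int) by rewrite /cover_shift add addrA.
  rewrite {1}/cover_shift /= => eq_y eq_x; apply: level_unique.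
  by rewrite shiftE eq_x -addrA eq_y addrA mulrDl.
split=> [[v l]|x y p|x y p].
- rewrite /cover_act /cover_shift (cocycle_act1 beP) /= one addr0; congr (_, _).
  by have [] := @level_unique 0 l%:Z l (esym (add0r _)).
- by rewrite /cover_act (cocycle_actM beP) /=; congr (_, _); case: (M x y p).
- by case: (M x y p).
Qed.

End CyclicCover.

Lemma level_ord s (l : 'I_s.+1) : level s l%:Z = l.
Proof. by have [] := @level_unique s 0%R l%:Z l (esym (add0r _)). Qed.

Lemma div_ord s (l : 'I_s.+1) : (l%:Z %/ s.+1)%Z = 0%R.
Proof. by have [] := @level_unique s 0%R l%:Z l (esym (add0r _)). Qed.

Lemma levelD s (q z : int) : level s (z + q * s.+1%:Z)%R = level s z /\
  ((z + q * s.+1%:Z) %/ s.+1)%Z = ((z %/ s.+1)%Z + q)%R.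
Proof.
apply: level_unique; rewrite mulrDl levelE.
by rewrite {1}(divz_eq z s.+1); lia.
Qed.

Section LabelShape.
Variables (E : groupType) (a : bool -> E) (J : finType) (act : E -> J -> J).
Variable be : E -> J -> zgroup.
Hypotheses (Ea : free2 a) (beP : cocycle act be).
Local Notation t := (a false).
Local Notation u := (a true).

(* The integers [m] within [D] of [p.2] contain all levels met by a path spelling
   [e] from [p], lifted to the infinite cyclic cover.  If those among them that
   reduce into [A] lie in a single period [c], then all powers of [u] met on
   the way are conjugated by the same [t^c] and add up. *)
Definition label_shape (D : nat) (e : E) : Prop :=
  (forall v, absz (be e v) <= D) /\
  forall s (A : pred 'I_s.+1) (al : E -> J * 'I_s.+1 -> zgroup)
      (lab : E -> J * 'I_s.+1 -> E),
    cocycle (cover_act act be (s := s)) al ->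
    (forall b p, ~~ A p.2 -> al (a b) p = 0%R) ->
    cocycle (cover_act act be (s := s)) lab ->
    (forall b p, lab (a b) p = zpow u (al (a b) p) * zpow t (winding be (a b) p)) ->
  forall (p : J * 'I_s.+1) (c : int),
    (forall m : int, absz (m - p.2%:Z)%R <= D -> A (level s m) ->
       (m %/ s.+1)%Z = c) ->
    lab e p = zpow t c * zpow u (al e p) * zpow t ((winding be e p : int) - c)%R.

Lemma label_shapeW D D' e : D <= D' -> label_shape D e -> label_shape D' e.
Proof.
move=> DD' [beD labD]; split=> [v|s A al lab alP alA labP laba p c pc].
  exact: leq_trans DD'.
apply: (labD s A) => // m mp; apply: pc; exact: leq_trans DD'.
Qed.

(** Induction on [e], with the radii added for products and doubled for inverses. Where two paths
    are joined, the powers of t between the two powers of u cancel. *)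
Lemma label_shape_exists e : exists D, label_shape D e.
Proof.
case: Ea => _ Eind.
elim/Eind: e => [|x y [D1 [be1 lab1]] [D2 [be2 lab2]]|x [D [beD labD]]|b].
- exists 0%N; split=> [v|s A al lab alP alA labP laba p c _].
    by rewrite (cocycle_lab1 beP).
  have -> : winding be 1 p = 0%R by exact: (cocycle_lab1 (cover_cocycle beP s)).
  rewrite (cocycle_lab1 labP) (cocycle_lab1 alP) mulg1 -zpowD.
  by rewrite add0r subrr.
- exists (D1 + D2); split=> [v|s A al lab alP alA labP laba p c pc].
    have -> : (be (x * y) v : int) = ((be x v : int) + be y (act x v))%R.
      exact: (cocycle_labM beP).
    by have := be1 v; have := be2 (act x v); lia.
  have wM : (winding be (x * y) p : int) =
      ((winding be x p : int) + winding be y (cover_act act be x p))%R.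
    exact: (cocycle_labM (cover_cocycle beP s)).
  have alM : (al (x * y) p : int) = ((al x p : int) + al y (cover_act act be x p))%R.
    exact: (cocycle_labM alP).
  have shiftE := cover_shiftE act be x p.
  rewrite (cocycle_labM labP) (lab1 s A al lab alP alA labP laba p c); last first.
    by move=> m mp; apply: pc; lia.
  (* The second path starts in the lift [winding be x p] periods further on, so relative to its own
     starting level the period c becomes [c - winding be x p]. *)
  rewrite (lab2 s A al lab alP alA labP laba _ (c - (winding be x p : int))%R); last first.
    move=> m mp Am; have [lev_m div_m] := levelD s (winding be x p : int) m.
    apply/eqP; rewrite eq_sym subr_eq; apply/eqP.
    rewrite -div_m; apply/esym/pc; last by rewrite lev_m.
    by have := be1 p.1; move: shiftE mp; rewrite /cover_shift; lia.
  rewrite wM alM (zpowD u) -!mulgA; congr (_ * (_ * _)).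
  rewrite [LHS]mulgA -zpowD (_ : _ + _ = 0)%R; last by lia.
  by rewrite zpow0 mul1g; congr (_ * zpow _ _); lia.
- exists (D + D); split=> [v|s A al lab alP alA labP laba p c pc].
    have -> : (be x^-1 v : int) = (- (be x (act x^-1 v) : int))%R.
      exact: (cocycle_labV beP).
    by rewrite abszN (leq_trans (beD _)) ?leq_addr.
  have coverP := cover_cocycle beP s; set q := cover_act act be x^-1 p.
  have qp : cover_act act be x q = p by rewrite (cocycle_actVK coverP).
  have wV : (winding be x^-1 p : int) = (- (winding be x q : int))%R.
    exact: (cocycle_labV coverP).
  have alV : (al x^-1 p : int) = (- (al x q : int))%R by exact: (cocycle_labV alP).
  have shiftE := cover_shiftE act be x q; rewrite qp in shiftE.
  rewrite (cocycle_labV labP) -/q.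
  rewrite (labD s A al lab alP alA labP laba _ (c + (winding be x q : int))%R); last first.
    move=> m mq Am; have [lev_m div_m] := levelD s (- (winding be x q : int))%R m.
    apply/eqP; rewrite -subr_eq -div_m; apply/eqP/pc; last by rewrite lev_m.
    by have := beD q.1; move: shiftE mq; rewrite /cover_shift; lia.
  rewrite wV alV !invgM -!zpowN mulgA; congr (_ * _ * _); congr zpow; lia.
- exists (\sum_v absz (be (a b) v))%N; split=> [v|s A al lab alP alA labP laba p c pc].
    by rewrite (bigD1 v) //= leq_addr.
  (* An edge starting outside [A] carries only a power of t, whatever c is; for one starting in [A],
     the integer [p.2] itself forces c = 0. *)
  rewrite laba; have [Ap|Ap] := boolP (A p.2); last first.
    by rewrite alA // zpow0 mul1g mulg1 -zpowD; congr zpow; lia.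
  have <- : 0%R = c.
    by rewrite -(div_ord p.2); apply: pc; rewrite ?level_ord // subrr.
  by rewrite zpow0 mul1g subr0.
Qed.

End LabelShape.

Lemma label_shape_seq (E : groupType) (a : bool -> E) (J : finType)
    (act : E -> J -> J) (be : E -> J -> zgroup) (T : eqType) (r : seq T) (f : T -> E) :
  free2 a -> cocycle act be ->
  exists D, forall x, x \in r -> label_shape a act be D (f x).
Proof.
move=> Ea beP; elim: r => [|x r [D shape_r]]; first by exists 0%N.
have [D' shape_x] := label_shape_exists Ea beP (f x).
exists (maxn D D') => y; rewrite inE => /predU1P[->|yr].
  exact: label_shapeW (leq_maxr _ _) shape_x.
exact: label_shapeW (leq_maxl _ _) (shape_r y yr).
Qed.

(** * Labels in the free group of rank two *)

Lemma virtual_labels (E : groupType) (a : bool -> E) (J : finType)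
    (act : E -> J -> J) (W : seq E) n :
  free2 a -> is_act act -> 0 < #|J| -> (forall v w, exists e, act e v = w) ->
  (forall w v, w \in W -> act (w ^+ n) v = v) ->
  (forall w v m, w \in W -> 0 < m <= size W -> act (w ^+ m) v <> v) ->
  exists (V : finType) (actV : E -> V -> V) (lab : E -> V -> E) (p : V)
      (z1 z2 : E) (k x y : int),
    [/\ cocycle actV lab,
      forall w v, w \in W -> actV (w ^+ n) v = v /\ lab (w ^+ n) v = 1,
      actV z1 p = p /\ lab z1 p = zpow (a true) k, k <> 0%R &
      actV z2 p = p /\ lab z2 p = zpow (a true) x * a false * zpow (a true) y].
Proof.
move=> Ea actP J0 trans Wn Wm; set m := size W in Wm.
have [|be [beP beW [e0 [v0 [e0v0 be_pos]]]]] :=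
  relator_loop Ea actP (M := m.+1) Wn _ (leqnn _) J0.
  by move=> w v i wW; rewrite ltnS; exact: Wm.
set b := absz (be e0 v0); have b0 : 0 < b by move: be_pos; rewrite /b; lia.
(* Conjugating the loop at [v0] by a path gives a loop of the same label b at every vertex. *)
have /choice[e eP] v : exists x, act x v = v /\ be x v = Posz b.
  have [h hv] := trans v v0; exists (h * e0 * h^-1); split.
    by rewrite !(cocycle_actM beP) hv e0v0 -hv (cocycle_actK beP).
  rewrite !(cocycle_labM beP) (cocycle_actM beP) hv e0v0 (cocycle_labV beP).
  rewrite -{2}hv (cocycle_actK beP) zgroupC mulKg /b.
  by move: be_pos; case: (be e0 v0 : int).
have [D1 shapeW] := label_shape_seq W (fun w => w ^+ n) Ea beP.
have [D2 shapeJ] := label_shape_seq (enum J) e Ea beP.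
have [D3 shapea] := label_shape_seq [:: true; false] a Ea beP.
set D := maxn D1 (maxn D2 D3).
have DD1 : D1 <= D by rewrite leq_maxl.
have DD2 : D2 <= D by rewrite /D; lia.
have DD3 : D3 <= D by rewrite /D; lia.
clearbody D.
(* As [s + 1 = b N], running N times through a loop of label b winds exactly once around the cover.
   The size of N is dictated by the count of equations for [al]. *)
pose N := (D * 4 * m.+1).+1; pose s := (b * N).-1.
have sE : s.+1 = (b * N)%N by rewrite prednK // muln_gt0 b0.
have ltN : D * 4 * m.+1 < s.+1 by rewrite sE /N; nia.
clearbody s; clearbody N.
(* A window of diameter [2 D] around a level in [0, s] meets [A] only in period 0. *)
pose A := [pred l : 'I_s.+1 | D <= l & l < s.+1 - D].
have cardA : s.+1 - 2 * D <= #|A|.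
  pose f (i : 'I_(s.+1 - 2 * D)) : 'I_s.+1 := inord (i + D).
  have fE i : f i = (i + D)%N :> nat by rewrite inordK //; have := ltn_ord i; lia.
  have f_inj : injective f.
    by move=> i j /(congr1 val) /=; rewrite !fE => /addIn/val_inj.
  rewrite -[X in X <= _]card_ord -(card_codom f_inj); apply: subset_leq_card.
  by apply/fintype.subsetP=> _ /codomP[i ->]; rewrite inE /= fE; have := ltn_ord i; lia.
have coverP := cover_cocycle beP s; set actV := cover_act act be (s:=s) in coverP.
have actVP : is_act actV.
  by split; [exact: (cocycle_act1 coverP) | exact: (cocycle_actM coverP)].
have shiftW w p : w \in W -> cover_shift be (w ^+ n) p = Posz p.2.
  by move=> wW; rewrite /cover_shift beW // addr0.
have actVn w p : w \in W -> actV (w ^+ n) p = p.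
  move=> wW; rewrite /actV /cover_act shiftW // level_ord Wn //.
  by case: p.
pose AV := [set p : J * 'I_s.+1 | A p.2].
have cardAV : #|AV| = (#|J| * #|A|)%N.
  rewrite -[#|J|]cardsT -[#|A|]cardsE -cardsX; apply: eq_card => p.
  by rewrite !inE.
have [|||al [alP al0 alW alf]] := @relator_labelling E a _ actV Ea actVP W n m.+1 AV.
- by move=> w p; exact: actVn.
- by move=> w [v l] i wW im /(congr1 fst) /=; apply: Wm.
(* With [#|A|] at least [s + 1 - 2D], the inequality follows from [4 D (m + 1) < s + 1]. *)
- rewrite card_prod card_ord cardAV -/m.
  have : #|J| * (D * 4 * m.+1) < #|J| * s.+1 by rewrite ltn_pmul2l.
  have : #|J| * (s.+1 - 2 * D) <= #|J| * #|A| by rewrite leq_mul2l cardA orbT.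
  by rewrite mulnBr; nia.
have [lab labP laba] := cocycle_extend Ea actVP (K := E)
  (fun c p => zpow (a true) (al (a c) p) * zpow (a false) (winding be (a c) p)).
have alA c (p : J * 'I_s.+1) : ~~ A p.2 -> al (a c) p = 0%R.
  by move=> Ap; apply: al0; rewrite inE.
have lab_shape x (p : J * 'I_s.+1) : label_shape a act be D x ->
    lab x p = zpow (a true) (al x p) * zpow (a false) (winding be x p).
  case=> _ /(_ s A al lab alP alA labP laba p 0%R) ->; last first.
    move=> i ip /andP[Di iD]; have := divz_eq i s.+1; rewrite -levelE.
    have := ltn_ord p.2; move: (i %/ _)%Z ip Di iD => q.
    move: (nat_of_ord (level s i)) (nat_of_ord p.2) => l l0 ip Dl lS.
    by move=> l0S iE; have [q0|q0|//] := ltgtP q 0%R; exfalso; nia.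
  by rewrite zpow0 mul1g subr0.
(* Otherwise the paths labelled by powers of u have a potential. Edges starting in [A] are too short
   to cross the cut, so their labels are [u^al], and [al] would agree on them with a coboundary. *)
have [z1 [p [k [z1p lab_z1 k0]]]] : exists z1 p k,
    [/\ actV z1 p = p, lab z1 p = zpow (a true) k & k <> 0%R].
  apply: contrapT => no_loop.
  have [||||f fP] := @integral_potential _
    (fun p q k => exists2 x, actV x p = q & lab x p = zpow (a true) k).
  - move=> q; exists 1; first exact: (cocycle_act1 labP).
    exact: (cocycle_lab1 labP).
  - move=> q q' k [x <- xq]; exists x^-1; first exact: (cocycle_actK labP).
    by rewrite (cocycle_labV labP) (cocycle_actK labP) xq zpowN.
  - move=> q q' q'' j k [x <- xq] [y <- yq]; exists (x * y).
      exact: (cocycle_actM labP).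
    by rewrite (cocycle_labM labP) xq yq zpowD.
  - move=> q k [x xq xk]; apply: contrapT => k0; apply: no_loop.
    by exists x, q, k.
  have [c [q [qA alq]]] := alf f; apply: alq; apply: fP; exists (a c) => //.
  rewrite laba; suff -> : winding be (a c) q = 0%R by rewrite zpow0 mulg1.
  have [bec _] := shapea c (ltac:(by case: c)).
  have := bec q.1; move: qA; rewrite inE /= => /andP[Dq qD] be_c.
  have lt : (0 <= cover_shift be (a c) q < s.+1%:Z)%R.
    by rewrite /cover_shift; move: (be (a c) q.1) be_c; rewrite /zgroup; lia.
  rewrite /winding; apply: divz_small; exact: lt.
exists (J * 'I_s.+1)%type, actV, lab, p, z1.
case: p z1p lab_z1 => v l z1p lab_z1; have [ev bev] := eP v.
have e_shift (q : 'I_s.+1) : cover_shift be (e v) (v, q) = (q%:Z + b%:Z)%R.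
  by rewrite /cover_shift bev.
have lab_e (q : 'I_s.+1) : exists j : int,
    lab (e v) (v, q) = zpow (a true) j * zpow (a false) ((q%:Z + b%:Z) %/ s.+1)%Z.
  exists (al (e v) (v, q)); rewrite lab_shape /winding ?e_shift //.
  by apply: label_shapeW DD2 (shapeJ _ _); rewrite mem_enum.
have levelS (z : int) (c : int) : level s ((level s z)%:Z + c)%R = level s (z + c)%R /\
    ((z + c) %/ s.+1)%Z = ((z %/ s.+1)%Z + (((level s z)%:Z + c)%R %/ s.+1)%Z)%R.
  have zcE : (z + c = (level s z)%:Z + c + (z %/ s.+1)%Z * s.+1%:Z)%R.
    by rewrite {1}(divz_eq z s.+1) levelE -addrA [LHS]addrC.
  have [] := levelD s (z %/ s.+1)%Z ((level s z)%:Z + c)%R.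
  by rewrite -zcE => -> ->; split=> //; exact: addrC.
have pow_e i : actV (e v ^+ i) (v, l) = (v, level s (l%:Z + (b * i)%:Z)%R).
  elim: i => [|i IH]; first by rewrite (cocycle_act1 labP) muln0 addr0 level_ord.
  rewrite expgSr (cocycle_actM labP) IH /actV /cover_act e_shift /= ev.
  by rewrite (levelS _ _).1 mulnS PoszD [(b%:Z + _)%R]addrC addrA.
(* Each step adds b to the lifted level, which goes from l to [l + s + 1] in N steps: the cut is
   crossed once, so t occurs at most once. *)
have pow_lab i : i <= N -> exists x y : int, lab (e v ^+ i) (v, l) =
    zpow (a true) x * zpow (a false) ((l%:Z + (b * i)%:Z)%R %/ s.+1)%Z * zpow (a true) y.
  elim: i => [_|i IH iN].
    exists 0%R, 0%R; rewrite (cocycle_lab1 labP) muln0 addr0 div_ord.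
    by rewrite !zpow0 !mulg1.
  have [x [y labi]] := IH (ltnW iN).
  rewrite expgSr (cocycle_labM labP) labi pow_e.
  have [j ->] := lab_e (level s (l%:Z + (b * i)%:Z)%R).
  have -> : Posz (b * i.+1)%N = (Posz (b * i)%N + Posz b)%R by rewrite mulnS addnC.
  rewrite addrA; set z := (_ + (b * i)%:Z)%R; have [_ ->] := levelS z (Posz b).
  set w := (z %/ _)%Z; set w' := (_ %/ _)%Z.
  have w0 : (0 <= w)%R by rewrite /w divz_ge0 // /z; lia.
  have w'0 : (0 <= w')%R by rewrite /w' divz_ge0 //; lia.
  have ww' : (w + w' <= 1)%R.
    rewrite -(levelS z (Posz b)).2 -ltzD1 ltz_divLR // /z.
    have := ltn_ord l; have : b * i.+1 <= s.+1 by rewrite sE leq_mul2l iN orbT.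
    by rewrite mulnS; lia.
  have [w'E|w'E] : w' = 0%R \/ w' = 1%R by lia.
    exists x, (y + j)%R; rewrite w'E zpow0 mulg1 addr0 zpowD.
    by rewrite !mulgA.
  (* The cut is crossed at this very step, so the label so far is a power of u and all powers of u
     stand before t. *)
  exists (x + y + j)%R, 0%R; rewrite w'E (_ : w = 0%R) ?zpow0; last by lia.
  by rewrite !zpowD !mulg1 !mulgA.
have [x [y lab_z2]] := pow_lab N (leqnn N).
have divN : ((l%:Z + (b * N)%:Z)%R %/ s.+1)%Z = 1%R /\
    level s (l%:Z + (b * N)%:Z)%R = l.
  have [] := levelD s 1%R (Posz l); rewrite mul1r -sE level_ord div_ord add0r.
  by [].
rewrite divN.1 in lab_z2.
exists (e v ^+ N), k, x, y; split=> //.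
- move=> w q wW; split; first exact: actVn.
  rewrite lab_shape; last exact: label_shapeW DD1 (shapeW w wW).
  by rewrite alW // /winding shiftW // div_ord !zpow0 mulg1.
- by split=> //; rewrite pow_e divN.2.
Qed.

(* Let [u] shift ['I_k] cyclically, with label [u] when it passes from [k - 1] to
   [0], and let [t], with label [t], shift it by [- (x + y)]. *)
Lemma cyclic_normalization (E : groupType) (a : bool -> E) (k x y : int) :
  free2 a -> (0 < k)%R ->
  exists (V : finType) (act : E -> V -> V) (lab : E -> V -> E) (o : V) (i j : int),
    [/\ cocycle act lab,
      act (zpow (a true) k) o = o /\ lab (zpow (a true) k) o = a true &
      let z := zpow (a true) x * a false * zpow (a true) y in
      act z o = o /\ lab z o = zpow (a true) i * a false * zpow (a true) j].
Proof.
case: k => // -[//|s] Ea _; set u := a true; set t := a false.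
(* The cover of degree [k = s + 1] of the graph with one vertex, where u has shift 1 and t has shift
   [-(x + y)]. The total shifts are k for [u^k] and 0 for [u^x t u^y], so both are loops at level
   0. *)
have [|be beP bea] := @cocycle_extend E a unit (fun _ v => v) Ea _ zgroup
  (fun b _ => if b then 1%R else (- (x + y))%R); first by [].
have coverP := cover_cocycle beP s; set act := cover_act _ be (s := s) in coverP.
have actP : is_act act.
  by split; [exact: (cocycle_act1 coverP) | exact: (cocycle_actM coverP)].
have [lab labP laba] := cocycle_extend Ea actP (K := E)
  (fun b p => if b then zpow u (winding be u p) else t).
have lab_u j p : lab (zpow u j) p = zpow u (winding be (zpow u j) p).
  elim/int_rect: j p => [|n IH|n IH] p.
  - by rewrite zpow0 (cocycle_lab1 labP) (cocycle_lab1 coverP).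
  - rewrite -addn1 PoszD zpowS (cocycle_labM labP) IH laba -zpowD.
    by rewrite (cocycle_labM coverP).
  - rewrite (_ : (- n.+1%:Z = - n%:Z - 1)%R); last by lia.
    rewrite zpow_pred (cocycle_labM labP) IH (cocycle_labV labP) laba -zpowN -zpowD.
    by rewrite (cocycle_labM coverP) (cocycle_labV coverP).
have be_u j : be (zpow u j) tt = j.
  elim/int_rect: j => [|n IH|n IH].
  - by rewrite zpow0 (cocycle_lab1 beP).
  - by rewrite -addn1 PoszD zpowS (cocycle_labM beP) IH bea.
  - rewrite (_ : (- n.+1%:Z = - n%:Z - 1)%R); last by lia.
    by rewrite zpow_pred (cocycle_labM beP) IH (cocycle_labV beP) bea.
pose o : unit * 'I_s.+1 := (tt, ord0).
have act_o z q : be z tt = (q * s.+1%:Z)%R -> act z o = o /\ winding be z o = q.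
  move=> bez; have [|lev div] := @level_unique s q (cover_shift be z o) ord0.
    by rewrite /cover_shift bez /= add0r addr0.
  by rewrite /act /cover_act lev /winding div.
exists (unit * 'I_s.+1)%type, act, lab, o.
exists (winding be (zpow u x) o), (winding be (zpow u y) (act (zpow u x * t) o)).
split=> //.
  have [|act_k wind_k] := act_o (zpow u s.+1) 1%R; first by rewrite be_u mul1r.
  by rewrite act_k lab_u wind_k.
have [|act_z _] := act_o (zpow u x * t * zpow u y) 0%R.
  rewrite !(cocycle_labM beP) !be_u bea mul0r.
  by change (x + - (x + y) + y = 0)%R; lia.
by split=> //; rewrite !(cocycle_labM labP) !lab_u laba.
Qed.

(** The two loops obtained generate E after the normalization: their new labels are [u] and
    [u^i t u^j]. *)
Lemma virtual_surjection (E : groupType) (a : bool -> E) (J : finType)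
    (act : E -> J -> J) (W : seq E) n :
  free2 a -> is_act act -> 0 < #|J| -> (forall v w, exists e, act e v = w) ->
  (forall w v, w \in W -> act (w ^+ n) v = v) ->
  (forall w v m, w \in W -> 0 < m <= size W -> act (w ^+ m) v <> v) ->
  exists (V : finType) (actV : E -> V -> V) (lab : E -> V -> E) (p : V),
    [/\ cocycle actV lab,
      forall w v, w \in W -> actV (w ^+ n) v = v /\ lab (w ^+ n) v = 1 &
      forall g, exists z, actV z p = p /\ lab z p = g].
Proof.
move=> Ea actP J0 trans Wn Wm.
have [V [actV [lab [p [z1 [z2 [k [x [y [labP labW [z1p lz1] k0 [z2p lz2]]]]]]]]]]] :=
  virtual_labels Ea actP J0 trans Wn Wm.
wlog k_gt0 : z1 k k0 z1p lz1 / (0 < k)%R => [th|].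
  have [|k_le0] := ltP 0%R k; first exact: th lz1.
  apply: (th z1^-1 (- k)%R); try by lia.
    by rewrite -{1}z1p (cocycle_actK labP).
  by rewrite (cocycle_labV labP) -{1}z1p (cocycle_actK labP) lz1 zpowN.
have [U [actU [labU [o [i [j [labUP [uo lu] [zo lz]]]]]]]] :=
  cyclic_normalization x y Ea k_gt0.
(* Composition of the two labellings: the second coordinate is moved by the first label. At [(p, o)]
   this is passage to a subgroup of the stabiliser of p. *)
pose act' e (q : V * U) := (actV e q.1, actU (lab e q.1) q.2).
pose lab' e (q : V * U) := labU (lab e q.1) q.2.
have labP' : cocycle act' lab'.
  split=> [[v q]|e e' [v q]|e e' [v q]].
  - rewrite /act' /= (cocycle_act1 labP) (cocycle_lab1 labP).
    by rewrite (cocycle_act1 labUP).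
  - rewrite /act' /= (cocycle_actM labP) (cocycle_labM labP).
    by rewrite (cocycle_actM labUP).
  - by rewrite /lab' /= (cocycle_labM labP) (cocycle_labM labUP).
exists (V * U)%type, act', lab', (p, o); split=> // [w [v q] wW|].
  have [wv lw] := labW w v wW; rewrite /act' /lab' /= wv lw.
  by rewrite (cocycle_act1 labUP) (cocycle_lab1 labUP).
pose im g := exists z, act' z (p, o) = (p, o) /\ lab' z (p, o) = g.
have imM g h : im g -> im h -> im (g * h).
  move=> [z [zp <-]] [z' [zp' <-]]; exists (z * z').
  by rewrite (cocycle_actM labP') (cocycle_labM labP') zp zp'.
have imV g : im g -> im g^-1.
  move=> [z [zp <-]]; exists z^-1; rewrite (cocycle_labV labP').
  by rewrite -{1 3}zp !(cocycle_actK labP').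
have im1 : im 1.
  by exists 1; rewrite (cocycle_act1 labP') (cocycle_lab1 labP').
have im_u : im (a true).
  by exists z1; rewrite /act' /lab' /= z1p lz1 uo lu.
have im_pow l : im (zpow (a true) l).
  have imX m : im (a true ^+ m).
    by elim: m => // m IH; rewrite expgS; apply: imM.
  by case: l => m /=; [|apply: imV]; exact: imX.
case: Ea => _ Eind; apply: Eind => // -[//|].
have -> : a false = zpow (a true) (- i)%R *
    (zpow (a true) i * a false * zpow (a true) j) * zpow (a true) (- j)%R.
  by rewrite !zpowN -!mulgA mulgV mulg1 mulKg.
apply: (imM) => //; apply: (imM) => //; exists z2.
by rewrite /act' /lab' /= z2p lz2 zo lz.
Qed.

(** E acts on its finite quotient by right translation, so a power of [w] acts freely once its image
    is not 1. Trivial words are filtered out first; their powers act trivially in any case. *)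
Lemma power_relators_killed (E : groupType) (a : bool -> E) (W : seq E) :
  free2 a -> eventually_nat (fun n =>
    exists (V : finType) (act : E -> V -> V) (lab : E -> V -> E) (p : V),
    [/\ cocycle act lab,
      forall w v, w \in W -> act (w ^+ n) v = v /\ lab (w ^+ n) v = 1 &
      forall g, exists z, act z p = p /\ lab z p = g]).
Proof.
move=> Ea; pose W' := [seq w <- W | w != 1].
have [|N quot] := @unipotent_quotients E a W' (size W').+1 Ea.
  by move=> w; rewrite mem_filter => /andP[/eqP].
exists N => n /quot[I [rho [rhoM rho_onto rhoW]]].
pose act e (v : I) : I := v * rho e.
have [|||||V [actV [lab [p [labP labW lab_onto]]]]] :=
  @virtual_surjection E a I act W' n Ea.
- by split=> [v|x y v]; rewrite /act ?(gmorph1 rhoM) ?mulg1 // rhoM mulgA.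
- by apply/card_gt0P; exists 1.
- by move=> v w; have [e re] := rho_onto (v^-1 * w); exists e; rewrite /act re mulKVg.
- by move=> w v /rhoW[w1 _]; rewrite /act (gmorphX rhoM) w1 mulg1.
- move=> w v m /rhoW[_ w1] mW; rewrite /act (gmorphX rhoM) => vw.
  by apply: (w1 m) => //; apply: (mulgI v); rewrite vw mulg1.
exists V, actV, lab, p; split=> // w v wW.
have [->|w1] := eqVneq w 1; last by apply: labW; rewrite mem_filter w1.
by rewrite expg1n (cocycle_act1 labP) (cocycle_lab1 labP).
Qed.

(** * From the free group of rank two to large groups *)

Local Open Scope classical_set_scope.

Lemma multiplicative_of (G K : groupType) (f : G -> K) :
  {morph f : x y / x * y} -> exists phi : {multiplicative G -> K}, phi =1 f.
Proof.
move=> fM; pose m := isMultiplicative.Build G K f fM.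
by pose phi : {multiplicative G -> K} := HB.pack f m; exists phi.
Qed.

Lemma groupClosed_of (G : groupType) (P : G -> Prop) :
  P 1 -> (forall x y, P x -> P y -> P (x * y)) -> (forall x, P x -> P x^-1) ->
  exists S : groupClosed G, forall x, x \in S <-> P x.
Proof.
move=> P1 PM PV; pose S : {pred G} := fun x => `[< P x >].
have SP x : x \in S <-> P x by split=> [/asboolW|/asboolT].
have SM : mulg_closed S by move=> x y /SP Px /SP Py; apply/SP/PM.
have S1 : 1 \in S by apply/SP.
have SV : invg_closed S by move=> x /SP Px; apply/SP/PV.
pose mM := isMulClosed.Build G S SM.
pose m1 := isMul1Closed.Build G S S1.
pose mV := isInvClosed.Build G S SV.
by pose T : groupClosed G := HB.pack S mM m1 mV; exists T.
Qed.

Lemma normalClosed_of (G : groupType) (P : G -> Prop) :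
  P 1 -> (forall x y, P x -> P y -> P (x * y)) -> (forall x, P x -> P x^-1) ->
  (forall x y, P x -> P (x ^ y)) ->
  exists S : normalClosed G, forall x, x \in S <-> P x.
Proof.
move=> P1 PM PV PJ; pose S : {pred G} := fun x => `[< P x >].
have SP x : x \in S <-> P x by split=> [/asboolW|/asboolT].
have SM : mulg_closed S by move=> x y /SP Px /SP Py; apply/SP/PM.
have S1 : 1 \in S by apply/SP.
have SV : invg_closed S by move=> x /SP Px; apply/SP/PV.
have SJ x y : x \in S -> x ^ y \in S by move=> /SP Px; apply/SP/PJ.
pose mM := isMulClosed.Build G S SM.
pose m1 := isMul1Closed.Build G S S1.
pose mV := isInvClosed.Build G S SV.
pose mJ := isNormalClosed.Build G S SJ.
by pose T : normalClosed G := HB.pack S mM m1 mV mJ; exists T.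
Qed.

(** The universal property implies generation: the inclusion of [X] in the subgroup defined by [P]
    extends to F, and followed by the embedding into F it is the identity by uniqueness. *)
Lemma basis_ind (F : groupType) (X : set F) (P : F -> Prop) : is_basis X ->
  P 1 -> (forall x y, P x -> P y -> P (x * y)) -> (forall x, P x -> P x^-1) ->
  (forall x, X x -> P x) -> forall x, P x.
Proof.
move=> basisX P1 PM PV PX x; have [S SP] := groupClosed_of P1 PM PV.
have [phi [phiX _]] := basisX (subgroup_of S) (fun z => insubd 1 z).
have [psi [_ psi_uniq]] := basisX F id.
have [iota iotaE] : exists iota : {multiplicative F -> F}, iota =1 (fun z => val (phi z)).
  by apply: multiplicative_of => y z; rewrite gmulfM valM.
have [idF idFE] : exists iota : {multiplicative F -> F}, iota =1 id.
  exact: multiplicative_of.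
apply/SP; suff -> : x = val (phi x) by exact: valP.
rewrite -iotaE -[x in LHS]idFE !psi_uniq // => z zX; rewrite ?idFE // iotaE.
by rewrite phiX // insubdK //; apply/SP/PX; rewrite in_setE in zX.
Qed.

Lemma free2_is_free (E : groupType) (a : bool -> E) : free2 a -> is_free E.
Proof.
move=> Ea; exists (range a) => K f.
have [h hM ha] := free2_hom (f \o a) Ea; have [phi phiE] := multiplicative_of hM.
exists phi; split=> [x|psi psiE x].
  by rewrite inE => -[b _ <-]; rewrite phiE ha.
have psiM : {morph psi : x y / x * y} by exact: gmulfM.
rewrite phiE; case: Ea => _ Eind; elim/Eind: x => [|x y IHx IHy|x IHx|b].
- by rewrite (gmorph1 psiM) (gmorph1 hM).
- by rewrite psiM IHx IHy hM.
- by rewrite (gmorphV psiM) IHx (gmorphV hM).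
- by rewrite psiE ?ha // inE; exists b.
Qed.

(** Cyclic groups are commutative, while the generators can be sent to two transpositions of three
    points that do not commute. *)
Lemma free2_not_cyclic (E : groupType) (a : bool -> E) : free2 a -> ~ is_cyclic E.
Proof.
move=> Ea [c cE].
pose i0 := @Ordinal 3 0 isT; pose i1 := @Ordinal 3 1 isT; pose i2 := @Ordinal 3 2 isT.
have [h hM ha] := free2_hom (fun b : bool => if b then tperm i0 i1 else tperm i1 i2) Ea.
have powC x : commute x c.
  by have [n [->|->]] := cE x; apply/commute_sym; [|apply: commuteV]; apply: commuteX.
have : commute (a true) (a false).
  by have [n [->|->]] := cE (a false); [|apply: commuteV]; apply: commuteX; apply: powC.
move/(congr1 h); rewrite !hM !ha => /permP/(_ i0).
by rewrite !permM !tpermL (tpermD (x := i1)) // tpermL.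
Qed.

(** A basis with at most one element generates a cyclic group, so there are two basis elements x and
    y. Killing the other ones is a retraction [rho] of F, and its fixed points form a free group on
    x and y. *)
Lemma free_onto_free2 (F : groupType) : is_free F -> ~ is_cyclic F ->
  exists (E : groupType) (a : bool -> E) (r : F -> E),
    [/\ free2 a, {morph r : x y / x * y} & forall y, exists x, r x = y].
Proof.
move=> [X basisX] Fnc; have Xind := basis_ind basisX.
have [x Xx] : exists x, X x.
  apply: contrapT => X0; apply: Fnc; exists 1 => z; exists 0%N; left.
  elim/Xind: z => [|y z -> ->|y ->|y Xy] //; rewrite ?mulg1 ?invg1 //.
  by case: X0; exists y.
have [y Xy yx] : exists2 y, X y & y != x.
  apply: contrapT => X1; apply: Fnc; exists x => z.
  have [k ->] : exists k, z = zpow x k.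
    elim/Xind: z => [|z z' [k ->] [k' ->]|z [k ->]|z Xz]; first by exists 0%R.
    - by exists (k + k')%R; rewrite zpowD.
    - by exists (- k)%R; rewrite zpowN.
    - exists 1%R; apply: contrapT => zx; apply: X1; exists z => //.
      by apply/eqP.
  by case: k => n; [exists n; left | exists n.+1; right].
have [rho [rhoX _]] := basisX F (fun z => if z \in [:: x; y] then z else 1).
have rhoM : {morph rho : z z' / z * z'} by exact: gmulfM.
have rhoV z : rho z^-1 = (rho z)^-1 by exact: (gmorphV rhoM).
have rhoE z : X z -> rho z = if z \in [:: x; y] then z else 1.
  by move=> Xz; apply: rhoX; rewrite inE.
have rhoK z : rho (rho z) = rho z.
  elim/Xind: z => [|z z' IH IH'|z IH|z Xz].
  - by rewrite !(gmorph1 rhoM).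
  - by rewrite !rhoM IH IH'.
  - by rewrite !rhoV IH.
  - rewrite (rhoE z) //; have [zxy|_] := boolP (z \in [:: x; y]).
      by rewrite rhoE // zxy.
    exact: (gmorph1 rhoM).
have [S SP] : exists S : groupClosed F, forall z, z \in S <-> rho z = z.
  apply: groupClosed_of => [|z z'|z]; rewrite ?(gmorph1 rhoM) ?rhoM ?rhoV //.
    by move=> -> ->.
  by move=> ->.
have rS z : rho z \in S by apply/SP.
pose r z : subgroup_of S := Sub (rho z) (rS z).
have rM : {morph r : z z' / z * z'}.
  by move=> z z'; apply: val_inj; rewrite valM /= rhoM.
have r_val (e : subgroup_of S) : r (val e) = e.
  by apply: val_inj => /=; apply/SP/valP.
exists (subgroup_of S), (fun b => r (if b then x else y)), r; split=> //; last first.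
  by move=> e; exists (val e).
split=> [K f|P P1 PM PV Pxy e].
  have [phi [phiX _]] := basisX K (fun z => if z == x then f true else
    if z == y then f false else 1).
  exists (fun e => phi (val e)) => [e e'|b]; first by rewrite valM gmulfM.
  rewrite /= rhoE; last by case: b.
  case: b; rewrite !inE eqxx ?orbT phiX ?inE ?eqxx //.
  by rewrite (negPf yx).
rewrite -(r_val e); move: (val e) => z; elim/Xind: z => [|z z' Pz Pz'|z Pz|z Xz].
- by rewrite (gmorph1 rM).
- by rewrite rM; apply: PM.
- by rewrite (gmorphV rM); apply: PV.
- have [->|zx] := eqVneq z x; first exact: (Pxy true).
  have [->|zy] := eqVneq z y; first exact: (Pxy false).
  suff -> : r z = 1 by [].
  by apply: val_inj; rewrite val1 /= rhoE // !inE (negPf zx) (negPf zy).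
Qed.

(** * Finite index subgroups and large quotients *)

Lemma finite_index_transversal (G : groupType) (S : groupClosed G) :
  finite_index S <-> exists T : seq G, forall x, exists2 t, t \in T & t^-1 * x \in S.
Proof.
split=> [/finite_seqP[s sE]|[T TS]].
  exists (map (xget 1) s) => x.
  have xs : left_coset S x \in s.
    by have : range (left_coset S) (left_coset S x) by []; rewrite sE.
  exists (xget 1 (left_coset S x)); first exact: map_f.
  have [h hS <-] : left_coset S x (xget 1 (left_coset S x)).
    by apply: xgetPex; exists x; exists 1; rewrite ?mulg1 //=; exact: gpred1.
  by rewrite invgM mulgVK gpredV.
apply: (@sub_finite_set _ _ (left_coset S @` [set` T])).
  2: exact/finite_image/finite_seq.
move=> _ [x _ <-]; have [t tT tx] := TS x; exists t => //.
apply/seteqP; split=> [_ [h hS <-]|_ [h hS <-]].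
  exists ((t^-1 * x)^-1 * h); first by rewrite /= gpredM ?gpredV.
  by rewrite invgM invgK !mulgA mulgV mul1g.
exists (t^-1 * x * h); first by rewrite /= gpredM.
by rewrite !mulgA mulgV mul1g.
Qed.

(** A homomorphism on [S] is given as a total map that is multiplicative on [S]; its values
    elsewhere are arbitrary. *)
Lemma large_from_onto (G : groupType) (S : groupClosed G) (E : groupType)
    (a : bool -> E) (f : G -> E) :
  free2 a -> finite_index S -> {in S &, {morph f : x y / x * y}} ->
  (forall y, exists2 x, x \in S & f x = y) -> is_large G.
Proof.
move=> Ea finS fM f_onto; exists S; split=> //.
have [h hE] : exists h : {multiplicative subgroup_of S -> E}, h =1 (fun x => f (val x)).
  by apply: multiplicative_of => x y; rewrite valM fM //; exact: valP.
exists E, h; split; [exact: free2_is_free Ea | exact: free2_not_cyclic Ea |].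
by move=> y; have [x xS fx] := f_onto y; exists (Sub x xS); rewrite hE.
Qed.

(** Representatives of a coset differ by an element of [N], which lies in [S] and is killed by [f].
    Hence membership in [S] and the value of [f] can be read on any representative. *)
Lemma large_quotient (G : groupType) (N : normalClosed G) (S : groupClosed G)
    (E : groupType) (a : bool -> E) (f : G -> E) :
  free2 a -> finite_index S -> {in S &, {morph f : x y / x * y}} ->
  (forall y, exists2 x, x \in S & f x = y) ->
  (forall x, x \in N -> x \in S /\ f x = 1) -> is_large (quotient_group N).
Proof.
move=> Ea finS fM f_onto NS; pose Q := quotient_group N.
have reprE x : exists2 d, d \in N & repr (quot N x) = x * d.
  by exists (x^-1 * repr (quot N x)); rewrite ?repr_quot ?mulVKg.
have repr_in x : repr (quot N x) \in S <-> x \in S.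
  by have [d /NS[dS _] ->] := reprE x; rewrite gpredMr.
have repr_f x : x \in S -> f (repr (quot N x)) = f x.
  by have [d /NS[dS fd] ->] := reprE x => xS; rewrite fM // fd mulg1.
have [S' S'P] : exists S' : groupClosed Q, forall q : Q, q \in S' <-> repr q \in S.
  apply: groupClosed_of => [|p q|q].
  - by apply/repr_in; exact: gpred1.
  - move=> pS qS; have -> : p * q = quot N (repr p * repr q).
      by rewrite quotM !quot_repr.
    by apply/repr_in/gpredM.
  - move=> qS; have -> : q^-1 = quot N (repr q)^-1.
      by rewrite -{1}(quot_repr q); exact: quot_invE.
    by apply/repr_in; rewrite gpredV.
apply: (@large_from_onto Q S' E a (f \o repr)) => //.
- have [T TS] := (finite_index_transversal S).1 finS.
  apply/finite_index_transversal; exists (map (quot N) T) => q.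
  have [t tT tq] := TS (repr q); exists (quot N t); first exact: map_f.
  apply/S'P; rewrite -{1}(quot_repr q).
  have -> : (quot N t)^-1 * quot N (repr q) = quot N (t^-1 * repr q).
    by rewrite quotM; congr (_ * _); exact: quot_invE.
  exact/repr_in.
- move=> p q /S'P pS /S'P qS /=; rewrite -fM // -[in LHS](quot_repr p).
  by rewrite -[in LHS](quot_repr q) -quotM repr_f ?gpredM.
- move=> y; have [x xS <-] := f_onto y; exists (quot N x); first by apply/S'P/repr_in.
  exact: repr_f.
Qed.

Lemma stabilizer_finite_index (G : groupType) (H S : groupClosed G)
    (V : finType) (act : G -> V -> V) (p : V) :
  finite_index H ->
  {in H &, forall x y v, act (x * y) v = act y (act x v)} ->
  (forall v, act 1 v = v) ->
  (forall x, x \in S <-> x \in H /\ act x p = p) -> finite_index S.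
Proof.
move=> /finite_index_transversal[T TH] actM act1 SP.
(* For each point v of the orbit of p under H, an element of H whose inverse takes p to v; elsewhere
   1 is a dummy. The products of these with a transversal of H meet every coset of [S]. *)
have /choice[h hP] v : exists h, h \in H /\
    ((exists2 x, x \in H & act x^-1 p = v) -> act h^-1 p = v).
  have [[x xH xv]|nov] := pselect (exists2 x, x \in H & act x^-1 p = v).
    by exists x.
  by exists 1; split; [exact: gpred1 | move/nov].
apply/finite_index_transversal; exists [seq t * h v | t <- T, v <- enum V] => x.
have [t tT txH] := TH x; pose y := t^-1 * x; pose v := act y^-1 p.
exists (t * h v); first by apply/allpairsP; exists (t, v); rewrite tT mem_enum.
have [hH hv] := hP v; rewrite invgM -mulgA -/y; apply/SP; split.
  by rewrite gpredM ?gpredV.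
rewrite actM ?gpredV // hv; last by exists y.
by rewrite /v -actM ?gpredV // mulVg act1.
Qed.

Theorem theorem1p1 (G : groupType) (H : normalClosed G) (k : nat)
    (g : 'I_k -> G) :
  is_large G ->
  finite_index H ->
  maps_onto_noncyclic_free (subgroup_of H) ->
  (forall i : 'I_k, g i \in H) ->
  finite_set [set n : nat |
    ~ is_large (quotient_group (normal_closure (range (fun i => g i ^+ n))))].
Proof.
move=> _ finH [F [f0 [freeF Fnc f0_onto]]] gH.
have [E [a [r [Ea rM r_onto]]]] := free_onto_free2 freeF Fnc.
pose phi (x : G) : E := r (f0 (insubd 1 x)).
have phiE (x : subgroup_of H) : phi (val x) = r (f0 x) by rewrite /phi valKd.
have phiM : {in H &, {morph phi : x y / x * y}}.
  move=> x y xH yH; pose x' : subgroup_of H := Sub x xH.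
  pose y' : subgroup_of H := Sub y yH.
  have -> : x * y = val (x' * y') by rewrite valM.
  by rewrite phiE gmulfM rM -!phiE.
have phi1 : phi 1 = 1.
  by apply: (mulgI (phi 1)); rewrite -phiM ?gpred1 // !mulg1.
have phiV x : x \in H -> phi x^-1 = (phi x)^-1.
  by move=> xH; apply: (mulgI (phi x)); rewrite -phiM ?gpredV // !mulgV.
have phiX x n : x \in H -> phi (x ^+ n) = phi x ^+ n.
  move=> xH; elim: n => [|n IH]; first exact: phi1.
  by rewrite !expgS phiM ?gpredXn // IH.
have [T TH] := (finite_index_transversal H).1 finH.
(* Conjugation by H becomes conjugation in E, but conjugation by G need not; so the conjugates of
   each [g i] by a transversal of H are all taken as words. *)
pose W := [seq phi (g i ^ t) | i <- enum 'I_k, t <- T].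
have [N killW] := power_relators_killed W Ea.
apply: (@sub_finite_set _ _ `I_N); last exact: finite_II.
move=> n; apply: contra_notP => /negP; rewrite -leqNgt => /killW.
move=> [V [act [lab [p [labP labW lab_onto]]]]].
have [S SP] : exists S : groupClosed G, forall x, x \in S <->
    x \in H /\ act (phi x) p = p.
  apply: groupClosed_of => [|x y [xH xp] [yH yp]|x [xH xp]].
  - by rewrite gpred1 phi1 (cocycle_act1 labP).
  - by rewrite gpredM // phiM // (cocycle_actM labP) xp yp.
  - by rewrite gpredV phiV // -{1}xp (cocycle_actK labP).
pose f x := lab (phi x) p.
have fM : {in S &, {morph f : x y / x * y}}.
  move=> x y /SP[xH xp] /SP[yH yp].
  by rewrite /f phiM // (cocycle_labM labP) xp.
have killed i c : (g i ^+ n) ^ c \in S /\ f ((g i ^+ n) ^ c) = 1.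
  (* Write [c = t h] with h in H: conjugation by t leads to a word of [W], and conjugation by h
     preserves trivial action and trivial labels. *)
  have [t tT tc] := TH c; rewrite -[c](mulVKg t) conjgM; set h := t^-1 * c in tc *.
  have gtH : g i ^ t \in H by exact: gpredJ_closed.
  have wW : phi (g i ^ t) \in W.
    by apply/allpairsP; exists (i, t); rewrite mem_enum.
  have -> : (g i ^+ n) ^ t = (g i ^ t) ^+ n by rewrite conjXg.
  have phiE' : phi (((g i ^ t) ^+ n) ^ h) = (phi (g i ^ t) ^+ n) ^ phi h.
    have gtnH : (g i ^ t) ^+ n \in H by exact: gpredXn.
    rewrite !conjgE phiM; [|by rewrite gpredV|exact: gpredM].
    by rewrite phiM // phiV // phiX.
  have [ap lp] := @cocycle_labJ _ _ _ _ _ labP (phi (g i ^ t) ^+ n) (phi h) p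
    (fun v => (labW _ v wW).1) (fun v => (labW _ v wW).2).
  split; last by rewrite /f phiE'.
  by apply/SP; split; [rewrite gpredJ ?gpredXn | rewrite phiE'].
(* The normal core in G of the kernel of [f] on [S]; it contains the powers, hence their normal
   closure. *)
have [D DP] : exists D : normalClosed G, forall x, x \in D <->
    forall c, x ^ c \in S /\ f (x ^ c) = 1.
  have f1 : f 1 = 1 by rewrite /f phi1 (cocycle_lab1 labP).
  apply: normalClosed_of => [c|x y xD yD c|x xD c|x y xD c].
  - by rewrite conj1g gpred1 f1.
  - have [xS fx] := xD c; have [yS fy] := yD c.
    by rewrite conjMg gpredM // fM // fx fy mulg1.
  - have [xS fx] := xD c; rewrite conjVg gpredV; split=> //.
    by apply: (mulgI (f (x ^ c))); rewrite -fM ?gpredV // mulgV fx mulg1.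
  - by rewrite -conjgM.
apply: (@large_quotient G _ S E a f) => //.
- apply: (@stabilizer_finite_index G H S V (fun x => act (phi x)) p) => //.
    by move=> x y xH yH v; rewrite phiM // (cocycle_actM labP).
  by move=> v; rewrite phi1 (cocycle_act1 labP).
- move=> y; have [z [zp <-]] := lab_onto y; have [q qz] := r_onto z.
  have [x xq] := f0_onto q; exists (val x); last by rewrite /f phiE xq qz.
  by apply/SP; rewrite phiE xq qz; split=> //; exact: valP.
- move=> x /asboolW/(_ D) xD; have /DP/(_ 1) : x \in D.
    by apply: xD => _ /set_mem[i _ <-]; apply/DP => c; exact: killed.
  by rewrite conjg1.
Qed.
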